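(* Let $m\ge 1$ and $0\le k<m$ be integers. (a) For each $d\ge 1$ there is a unique rational map $$\mathfrak{R}_{d,m,k}:\mathbb{P}^{2d+1}_{\mathbb{Z}}\dashrightarrow\mathbb{P}^{2d+1}_{\mathbb{Z}}$$ with the property that for all fields $K$ in which $m\ne 0$ and for all degree $d$ rational functions $\varphi_{\boldsymbol a,\boldsymbol b}(z)\in \mathrm{Rat}_d(K)\subset K(z)$ whose $(m,k)$-Landen transform satisfies $$\deg_z \mathfrak{F}_{m,k}(\varphi_{\boldsymbol a,\boldsymbol b})(z)=d,$$ we have $$\mathfrak{F}_{m,k}(\varphi_{\boldsymbol a,\boldsymbol b})(z)=\mathfrak{R}_{d,m,k}\bigl([\boldsymbol a,\boldsymbol b]\bigr).$$ (b) The indeterminacy locus of $\mathfrak{R}_{d,m,k}$ is the linear subspace $$\mathcal{Z}(\mathfrak{R}_{d,m,k})=\bigl\{[\boldsymbol a,\boldsymbol b]\in\mathbb{P}^{2d+1}_{\mathbb{Z}}:\boldsymbol b=\boldsymbol 0\bigr\}\cong\mathbb{P}^d,$$ and the rational map $\mathfrak{R}_{d,m,k}$ induces a morphism $$\mathfrak{R}_{d,m,k}:\mathbb{P}^{2d+1}_{\mathbb{Z}}\smallsetminus\mathcal{Z}(\mathfrak{R}_{d,m,k})\longrightarrow\mathbb{P}^{2d+1}_{\mathbb{Z}}\smallsetminus\mathcal{Z}(\mathfrak{R}_{d,m,k}).$$ (c) The map $\mathfrak{R}_{d,m,0}:\mathbb{P}^{2d+1}_{\mathbb{Z}}\dashrightarrow\mathbb{P}^{2d+1}_{\mathbb{Z}}$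 is a dominant rational map of algebraic degree $m$. (d) For $1\le k<m$, the image of the rational map $\mathfrak{R}_{d,m,k}$ is the hyperplane $$\bigl\{[\boldsymbol a,\boldsymbol b]\in\mathbb{P}^{2d+1}_{\mathbb{Z}}:a_0=0\bigr\}\cong\mathbb{P}^{2d}_{\mathbb{Z}}.$$ For all $0\le k<m$, the map $\mathfrak{R}_{d,m,k}$ induces a dominant rational map of algebraic degree $m$ from this hyperplane $\{a_0=0\}$ to itself.
   Context: Landen transform: for a field $K$ in which $m\neq 0$, with $\zeta_m$ a primitive $m$-th root of unity in an extension field of $K$, and $\varphi\in K(z)$, the $(m,k)$-Landen transform $\mathfrak{F}_{m,k}(\varphi)(z)\in K(z)$ is the unique rational function satisfying $$\mathfrak{F}_{m,k}(\varphi)(w^m)=\frac{1}{mw^k}\sum_{t=0}^{m-1}\zeta_m^{-kt}\varphi(\zeta_m^t w),$$ where $w$ is an indeterminate. Coordinates: for $\boldsymbol a=(a_0,\dots,a_d)$ and $\boldsymbol b=(b_0,\dots,b_d)$, write $[\boldsymbol a,\boldsymbol b]=[a_0,\dots,a_d,b_0,\dots,b_d]\in\mathbb{P}^{2d+1}$ and $$\varphi_{\boldsymbol a,\boldsymbol b}(z)=\frac{a_0z^d+a_1z^{d-1}+\cdots+a_d}{b_0z^d+b_1z^{d-1}+\cdots+b_d}.$$ $\mathrm{Rat}_d$ denotes the space of rational functions of degree $d$, identified via $\varphi_{\boldsymbol a,\boldsymbol b}\leftrightarrow[\boldsymbol a,\boldsymbol b]$ with the affine open subset of $\mathbb{P}^{2d+1}$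 (as a scheme over $\mathbb{Z}$) where the resultant of the numerator and denominator, viewed as homogeneous forms of degree $d$, is nonzero. The equality in (a) is understood via this identification. The algebraic degree of a rational map $f:\mathbb{P}^N\dashrightarrow\mathbb{P}^N$ is the integer $e$ with $f^*\mathcal{O}_{\mathbb{P}^N}(1)=\mathcal{O}_{\mathbb{P}^N}(e)$.
   Formalization: In (b), the equality of the indeterminacy locus with {b=0} is stated only for m≥2: for m=1 the map is the identity, whose indeterminacy locus is empty; the self-morphism is stated on the complement of {b=0} for all m≥1. In (d), the image is read as the Zariski closure. *)

(* Defs.v *)
From HB Require Import structures.
From mathcomp Require Import all_boot all_order all_algebra.
From mathcomp.multinomials Require Import mpoly.

Set Implicit Arguments.
Unset Strict Implicit.
Unset Printing Implicit Defensive.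

Import GRing.Theory.
Local Open Scope ring_scope.

(** * Projective space over Z, through its field-valued points

    A point of the scheme P^(n-1)_Z is given by a field K and a nonzero vector
    of K^n up to scaling; every scheme point arises in this way (take K to be
    its residue field).  A subset of P^(n-1)_Z is accordingly a predicate on
    such vectors, for all K.  NB: n is the number of homogeneous coordinates. *)

Definition locus (n : nat) := forall K : fieldType, 'rV[K]_n -> Prop.

Definition mpoly_at (n : nat) (K : fieldType) (p : {mpoly int[n]})
    (x : 'rV[K]_n) : K :=
  mmap intr (x 0) p.

Definition proj_eq (n : nat) (K : fieldType) (x y : 'rV[K]_n) : Prop :=
  exists2 c : K, c != 0 & y = c *: x.

(** Zariski closure in P^(n-1)_Z: the closed subsets are the common zero loci
    of homogeneous polynomials with integer coefficients. *)
Definition zclosure (n : nat) (Z : locus n) : locus n :=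
  fun K y =>
    y != 0 /\
    forall (e : nat) (h : {mpoly int[n]}), h \is e.-homog ->
      (forall (F : fieldType) (x : 'rV[F]_n), Z F x -> mpoly_at h x = 0) ->
      mpoly_at h y = 0.

(** Z is the image of the closed immersion P^(r-1)_Z -> P^(n-1)_Z, [u] |-> [uM].
    The integral right inverse M' makes Z[x_1..x_n] -> Z[u_1..u_r] surjective,
    so that this is a closed immersion over Z. *)
Definition linear_subspace_iso (n r : nat) (Z : locus n) : Prop :=
  exists (M : 'M[int]_(r, n)) (M' : 'M[int]_(n, r)),
    M *m M' = 1%:M /\
    forall (K : fieldType) (x : 'rV[K]_n), x != 0 ->
      (Z K x <-> exists u : 'rV[K]_r, x = u *m map_mx intr M).

(** * Rational maps P^(n-1)_Z --> P^(r-1)_Z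

    As P^(n-1)_Z is integral with fraction field of degree-0 homogeneous
    fractions, a rational map is given by a nonzero tuple of integral forms of
    the same degree, two tuples defining the same map iff they are proportional
    ([ratmap_eq]).  Tuples may have common factors. *)
Record ratmap (n r : nat) := RatMap {
  rm_coord :> 'I_r -> {mpoly int[n]};
  rm_deg : nat;
  rm_homog : forall i, rm_coord i \is rm_deg.-homog;
  rm_neq0 : exists i, rm_coord i != 0
}.

Definition ratmap_eq (n r : nat) (f g : ratmap n r) : Prop :=
  forall i j, f i * g j = f j * g i.

Definition ratmap_at (n r : nat) (K : fieldType) (f : ratmap n r)
    (x : 'rV[K]_n) : 'rV[K]_r :=
  \row_i mpoly_at (f i) x.

(** f is defined at x iff some tuple representing f does not vanish at x. *)
Definition defined_at (n r : nat) (K : fieldType) (f : ratmap n r)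
    (x : 'rV[K]_n) : Prop :=
  exists2 g : ratmap n r, ratmap_eq f g & ratmap_at g x != 0.

(** f is defined at x, and f([x]) = [y] *)
Definition maps_to (n r : nat) (K : fieldType) (f : ratmap n r)
    (x : 'rV[K]_n) (y : 'rV[K]_r) : Prop :=
  exists2 g : ratmap n r, ratmap_eq f g &
    ratmap_at g x != 0 /\ proj_eq (ratmap_at g x) y.

Definition indeterminacy (n r : nat) (f : ratmap n r) : locus n :=
  fun K x => x != 0 /\ ~ defined_at f x.

(** The image of a rational map is the closure of the image of its domain of
    definition (equivalently, the projection of the closure of its graph). *)
Definition ratmap_image (n r : nat) (f : ratmap n r) : locus r :=
  zclosure (fun K y => exists2 x : 'rV[K]_n, x != 0 & maps_to f x y).

Definition dominant (n r : nat) (f : ratmap n r) : Prop :=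
  forall (K : fieldType) (y : 'rV[K]_r), y != 0 -> ratmap_image f y.

(** f^*O(1) = O(e): on the domain of definition U of f, an isomorphism of
    f^*O(1) with O(e)|U amounts to sections s_1..s_r of O(e) on U without
    common zero in U such that f = [s_1 : .. : s_r].  The complement of U having
    codimension at least 2, such sections are forms of degree e. *)
Definition algebraic_degree (n r : nat) (f : ratmap n r) (e : nat) : Prop :=
  exists g : ratmap n r,
    [/\ ratmap_eq f g, rm_deg g = e &
        forall (K : fieldType) (x : 'rV[K]_n), x != 0 ->
          defined_at f x -> ratmap_at g x != 0].

(** * Rational functions in one variable *)

Notation ratfun K := {fraction {poly K}}.

Definition ratC (K : fieldType) (c : K) : ratfun K := FracField.tofrac c%:P.
Definition ratX (K : fieldType) : ratfun K := FracField.tofrac 'X.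
Arguments ratX {K}.

(** f(g), for f in K(z) and g in L(w), where iota : K -> L.  The value does not
    depend on the representative n/d chosen for f as soon as g is not constant,
    the only case in which this is used. *)
Definition ratcomp (K L : fieldType) (iota : {rmorphism K -> L})
    (f : ratfun K) (g : ratfun L) : ratfun L :=
  (map_poly (fun c => ratC (iota c)) \n_(repr f)).[g] /
  (map_poly (fun c => ratC (iota c)) \d_(repr f)).[g].

Definition ratdeg (K : fieldType) (f : ratfun K) : nat :=
  let p := \n_(repr f) in
  let q := \d_(repr f) in
  (maxn (size (p %/ gcdp p q)) (size (q %/ gcdp p q))).-1.

(** psi is the (m,k)-Landen transform of phi, computed with the primitive m-th
    root of unity zeta of the extension iota : K -> L of K. *)
Definition is_landen (K L : fieldType) (iota : {rmorphism K -> L}) (zeta : L)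
    (m k : nat) (phi psi : ratfun K) : Prop :=
  ratcomp iota psi (ratX ^+ m) =
  (m%:R * ratX ^+ k)^-1 *
  \sum_(t < m) ratC (zeta ^- (k * t)) * ratcomp iota phi (ratC (zeta ^+ t) * ratX).

(** * Coordinates [a,b] on P^(2d+1), where a = lsubmx x and b = rsubmx x *)

Definition form_poly (K : fieldType) (d : nat) (a : 'rV[K]_d.+1) : {poly K} :=
  \sum_(i < d.+1) a 0 i *: 'X^(d - i).

Definition phi_ab (K : fieldType) (d : nat) (x : 'rV[K]_(d.+1 + d.+1)) :
    ratfun K :=
  FracField.tofrac (form_poly (lsubmx x)) / FracField.tofrac (form_poly (rsubmx x)).

(** Sylvester rows of a form of degree d: row i is a, shifted i places right *)
Definition sylvester_rows (K : fieldType) (d : nat) (a : 'rV[K]_d.+1) :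
    'M[K]_(d, d + d) :=
  \matrix_(i, j) (if (i <= j <= i + d)%N then a 0 (inord (j - i)) else 0).

(** Resultant of two binary forms of degree d.  The library's [resultant] uses
    the actual degrees of the polynomials, hence differs from this one when
    leading coefficients vanish. *)
Definition form_resultant (K : fieldType) (d : nat) (a b : 'rV[K]_d.+1) : K :=
  \det (col_mx (sylvester_rows a) (sylvester_rows b)).

Definition in_Rat (K : fieldType) (d : nat) (x : 'rV[K]_(d.+1 + d.+1)) : Prop :=
  form_resultant (lsubmx x) (rsubmx x) != 0.

Definition landen_property (d m k : nat)
    (R : ratmap (d.+1 + d.+1) (d.+1 + d.+1)) : Prop :=
  forall K : fieldType, m%:R != 0 :> K ->
  forall (L : fieldType) (iota : {rmorphism K -> L}) (zeta : L),
    m.-primitive_root zeta ->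
  forall (x : 'rV[K]_(d.+1 + d.+1)) (psi : ratfun K),
    in_Rat x -> is_landen iota zeta m k (phi_ab x) psi -> ratdeg psi = d ->
  exists y : 'rV[K]_(d.+1 + d.+1),
    [/\ maps_to R x y, in_Rat y & phi_ab y = psi].

Definition b_zero (d : nat) : locus (d.+1 + d.+1) :=
  fun K x => x != 0 /\ rsubmx x = 0.

Definition a0_zero (d : nat) : locus (d.+1 + d.+1) :=
  fun K x => x != 0 /\ lsubmx x 0 ord0 = 0.

(** P^(2d) -> P^(2d+1), [a_1..a_d,b_0..b_d] |-> [0,a_1..a_d,b_0..b_d] *)
Definition a0_incl (K : fieldType) (d : nat) (u : 'rV[K]_(d + d.+1)) :
    'rV[K]_(d.+1 + d.+1) :=
  row_mx (0 : 'rV[K]_1) u.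

(** The restriction of R to the hyperplane a_0 = 0 makes sense, and is the
    rational self-map S of this hyperplane. *)
Definition induces_on_a0 (d : nat) (R : ratmap (d.+1 + d.+1) (d.+1 + d.+1))
    (S : ratmap (d + d.+1) (d + d.+1)) : Prop :=
  (exists (K : fieldType) (u : 'rV[K]_(d + d.+1)),
     u != 0 /\ defined_at R (a0_incl u)) /\
  forall (K : fieldType) (u : 'rV[K]_(d + d.+1)) (y : 'rV[K]_(d.+1 + d.+1)),
    u != 0 -> maps_to R (a0_incl u) y ->
    exists2 v : 'rV[K]_(d + d.+1), maps_to S u v & y = a0_incl v.

(* Main.v *)
Require Import Defs.
From HB Require Import structures.
From mathcomp Require Import all_boot all_order all_algebra.
From mathcomp Require Import perm algC cyclotomic separable.
From mathcomp.multinomials Require Import mpoly.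
From mathcomp Require Import ring zify.

Set Implicit Arguments.
Unset Strict Implicit.
Unset Printing Implicit Defensive.

Import GRing.Theory.
Local Open Scope ring_scope.

(** Write phi = A/B.  The circulant matrix whose (i,j) entry is the part of B of
    exponents congruent to j - i mod m has eigenvector (1,..,1) with eigenvalue
    B, so its determinant is B H with H the sum of the first row of its
    adjugate, and it only involves powers of w^m: it is the norm N(w^m) of B.
    As phi = A H / N(w^m), its Landen transform is P/N, where P collects the
    coefficients of A H at the exponents congruent to k.  The coefficients of P
    and N are integral forms of degree m in [a,b], which define R over Z.

    N has the extreme coefficients +-b_0^m and b_d^m, so any tuple representing
    R is a multiple of (P,N); hence R is defined exactly where (P,N) <> 0, and
    has degree m.  N <> 0 as soon as b <> 0.

    For dominance, let N be separable over algC, of degree d, with N(0) <> 0.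
    It is the norm of a B whose roots g are m-th roots of the roots of N, and
    A |-> P is injective on degrees < d: as m g^k P(g^m) = A(g) H(g) and
    H(g) <> 0, P = 0 makes A vanish at the d roots of B.  Such N are dense. *)

(** * Determinants of graded matrices *)

Section GradedDeterminant.

Variables (G : nmodType) (A : comNzRingType) (D : G -> A -> Prop).
Hypothesis D0 : forall g, D g 0.
Hypothesis DD : forall g x y, D g x -> D g y -> D g (x + y).
Hypothesis DN : forall g x, D g x -> D g (- x).
Hypothesis D1 : D 0 1.
Hypothesis DM : forall g h x y, D g x -> D h y -> D (g + h) (x * y).

Lemma graded_sum (I : Type) (r : seq I) (P : pred I) (F : I -> A) (g : G) :
  (forall i, P i -> D g (F i)) -> D g (\sum_(i <- r | P i) F i).
Proof. by move=> DF; apply: big_ind => //; exact: DD. Qed.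

Lemma graded_prod (I : Type) (r : seq I) (F : I -> A) (w : I -> G) :
  (forall i, D (w i) (F i)) -> D (\sum_(i <- r) w i) (\prod_(i <- r) F i).
Proof. by move=> DF; apply: (big_ind2 D) => // *; apply: DM. Qed.

Lemma graded_sign (b : bool) (g : G) (x : A) : D g x -> D g ((-1) ^+ b * x).
Proof. by case: b => Dx; rewrite ?expr0 ?expr1 ?mul1r ?mulN1r //; apply: DN. Qed.

(** Each Leibniz term is a product of homogeneous entries whose weights add up to [g]. The gradings
    used below are the residue of an exponent, a degree bound, and the total degree of the
    coefficients. *)
Lemma graded_det (n : nat) (M : 'M[A]_n) (w : 'I_n -> 'I_n -> G) (g : G) :
  (forall i j, D (w i j) (M i j)) ->
  (forall s : {perm 'I_n}, \sum_i w i (s i) = g) -> D g (\det M).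
Proof.
move=> DM_ Dg; apply: graded_sum => s _; apply: graded_sign.
by rewrite -(Dg s); apply: graded_prod.
Qed.

End GradedDeterminant.

Lemma graded_det_const (A : comNzRingType) (D : nat -> A -> Prop) :
  (forall g, D g 0) -> (forall g x y, D g x -> D g y -> D g (x + y)) ->
  (forall g x, D g x -> D g (- x)) -> D 0 1 ->
  (forall g h x y, D g x -> D h y -> D (g + h)%N (x * y)) ->
  forall (n e : nat) (M : 'M[A]_n), (forall i j, D e (M i j)) ->
  D (e * n)%N (\det M).
Proof.
move=> D0 DD DN D1 DM n e M DMe.
refine (@graded_det nat A D D0 DD DN D1 DM n M (fun _ _ => e) (e * n)%N DMe _).
by move=> s; rewrite sumr_const card_ord -mulr_natr !natrE.
Qed.

Lemma size_mul_bound (R : comNzRingType) (p q : {poly R}) (a b : nat) :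
  (size p <= a.+1)%N -> (size q <= b.+1)%N -> (size (p * q)%R <= (a + b).+1)%N.
Proof.
move=> sp sq; apply: leq_trans (size_polyMleq _ _) _.
by case: (size p + size q)%N (leq_add sp sq) => //= l; rewrite addnS.
Qed.

Lemma coef_mul_top (R : comNzRingType) (p q : {poly R}) (a b : nat) :
  (size p <= a.+1)%N -> (size q <= b.+1)%N -> (p * q)`_(a + b) = p`_a * q`_b.
Proof.
move=> sp sq; rewrite coefM (bigD1 (inord a)) //= inordK ?ltnS ?leq_addr //.
rewrite addKn big1 ?addr0 // => j; rewrite -val_eqE /= inordK ?ltnS ?leq_addr //.
case: ltngtP => // ja _.
  rewrite [X in _ * X]nth_default ?mulr0 //; apply: leq_trans sq _.
  by rewrite ltn_subRL ltn_add2r.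
by rewrite nth_default ?mul0r //; apply: leq_trans sp _.
Qed.

Lemma size_det_poly (R : comNzRingType) (n e : nat) (M : 'M[{poly R}]_n) :
  (forall i j, (size (M i j) <= e.+1)%N) -> (size (\det M) <= (e * n).+1)%N.
Proof.
move=> sM; refine (@graded_det_const {poly R}
  (fun g (p : {poly R}) => is_true (size p <= g.+1)%N) _ _ _ _ _ n e M sM).
- by move=> g; rewrite size_poly0.
- move=> g p q sp sq; rewrite (leq_trans (size_polyD _ _)) // geq_max sp.
  by rewrite sq.
- by move=> g p; rewrite size_polyN.
- by rewrite size_poly1.
- by move=> g h p q; apply: size_mul_bound.
Qed.

(** Taking the formal top coefficient, possibly zero, is additive, and multiplicative under degree
    bounds, hence it commutes with the Leibniz formula. *)
Lemma coef_det_top (R : comNzRingType) (n e : nat) (M : 'M[{poly R}]_n) :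
  (forall i j, (size (M i j) <= e.+1)%N) ->
  (\det M)`_(e * n) = \det (\matrix_(i, j) (M i j)`_e).
Proof.
move=> sM; rewrite /determinant coef_sum; apply: eq_bigr => s _.
have -> : \prod_i (\matrix_(i, j) (M i j)`_e) i (s i) = (\prod_i M i (s i))`_(e *
  n).
  under eq_bigr do rewrite mxE.
  (* The size bound is carried along the induction because [coef_mul_top] needs it. *)
  suff H (r : seq 'I_n) : (size (\prod_(i <- r) M i (s i))%R <= (e * size
    r).+1)%N /\
      (\prod_(i <- r) M i (s i))`_(e * size r) = \prod_(i <- r) (M i (s i))`_e.
    by have [_] := H (enum 'I_n); rewrite size_enum_ord !big_enum.
  elim: r => [|i r [sr cr]]; first by rewrite !big_nil muln0 coef1 size_poly1.
  rewrite !big_cons /= mulnS -cr.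
  by split; [apply: size_mul_bound | apply: coef_mul_top].
by case: (odd_perm s); rewrite ?expr1 ?expr0 ?mulN1r ?mul1r ?coefN.
Qed.

(** * Norms and circulant matrices *)

(* From here on the index m stands for the m - 1 of the statement, so that the
   residue classes form the additive group 'I_m.+1. *)
Section Circulant.

Variables (R : comNzRingType) (m : nat).
Implicit Types (p q : {poly R}) (c : 'I_m.+1).

Definition residue_part c p : {poly R} :=
  \poly_(l < size p) (if inZp l == c then p`_l else 0).

Definition circulant p : 'M[{poly R}]_m.+1 :=
  \matrix_(i, j) residue_part (j - i) p.

(** Conjugating by the diagonal matrix of powers of w turns [circulant p] into the matrix of
    multiplication by p on the basis 1, w, .., w^m over the polynomials in w^(m+1). So [cnorm] is
    the norm of that extension, obtained without roots of unity. *)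
Definition cnorm p : {poly R} := \det (circulant p).

(** Stands for the product of the conjugates p(zeta^t w) with t nonzero, but makes sense over any
    commutative ring. *)
Definition cofactor_sum p : {poly R} := (\adj (circulant p) *m const_mx 1 :
  'cV_m.+1) 0 0.

Definition section (k : nat) p : {poly R} := \poly_(l < size p) p`_(m.+1 * l + k).

Lemma coef_residue_part c p l :
  (residue_part c p)`_l = if inZp l == c then p`_l else 0.
Proof.
rewrite coef_poly; case: ltnP => // sl.
by rewrite nth_default // if_same.
Qed.

Lemma coef_section k p l : (section k p)`_l = p`_(m.+1 * l + k).
Proof.
rewrite coef_poly; case: ltnP => // sl; rewrite nth_default //.
by apply: leq_trans sl _; rewrite mulSn -addnA leq_addr.
Qed.

Lemma inZpD a b : inZp (a + b) = inZp a + inZp b :> 'I_m.+1.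
Proof. by apply: val_inj; rewrite /= modnDm. Qed.

Lemma inZp0 : inZp 0 = 0 :> 'I_m.+1.
Proof. by apply: val_inj; rewrite /= mod0n. Qed.

Lemma sum_residue_part p : \sum_c residue_part c p = p.
Proof.
apply/polyP=> l; rewrite coef_sum (bigD1 (inZp l)) //= coef_residue_part eqxx.
rewrite big1 ?addr0 // => c; rewrite coef_residue_part eq_sym.
by case: eqP.
Qed.

Lemma size_residue_part c p : (size (residue_part c p) <= size p)%N.
Proof. exact: size_poly. Qed.

Lemma circulant_ones p :
  circulant p *m const_mx 1 = p *: const_mx 1 :> 'cV_m.+1.
Proof.
apply/matrixP=> i j; rewrite !mxE mulr1 -[RHS]sum_residue_part.
rewrite [RHS](reindex_inj (addIr (- i))) /=; apply: eq_bigr => l _.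
by rewrite !mxE mulr1.
Qed.

(** The product of the adjugate, the circulant and the all-ones column is computed in two ways: the
    first two factors give the determinant, the last two give p times the column. *)
Lemma mul_cofactor_sum p : p * cofactor_sum p = cnorm p.
Proof.
have /matrixP/(_ 0 0): \adj (circulant p) *m (circulant p *m const_mx 1) =
    cnorm p *: const_mx 1 :> 'cV_m.+1.
  by rewrite mulmxA mul_adj_mx mul_scalar_mx.
by rewrite circulant_ones -scalemxAr [LHS]mxE => ->; rewrite !mxE mulr1.
Qed.

Definition in_residue c p := forall l, inZp l != c -> p`_l = 0.

(** The entry (i,j) has residue j - i, and these weights sum to 0 along any permutation. *)
Lemma in_residue_cnorm p : in_residue 0 (cnorm p).
Proof.
apply: (@graded_det _ _ in_residue _ _ _ _ _ _ _ (fun i j => j - i)).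
- by move=> g l _; rewrite coef0.
- by move=> g p1 p2 D1 D2 l lg; rewrite coefD D1 // D2 // addr0.
- by move=> g p1 D1 l lg; rewrite coefN D1 ?oppr0.
- by move=> l; rewrite coef1; case: l => //; rewrite inZp0 eqxx.
- move=> g h p1 p2 D1 D2 l lgh; rewrite coefM big1 // => -[j jl] _ /=.
  have [jg|] := eqVneq (inZp j) g; last by move=> /D1 ->; rewrite mul0r.
  rewrite D2 ?mulr0 //; apply: contraNneq lgh => <-.
  by rewrite -jg -inZpD subnKC.
- by move=> i j l; rewrite mxE coef_residue_part => /negPf ->.
- move=> s; rewrite sumrB [X in _ - X](reindex_inj (@perm_inj _ s)) subrr //.
Qed.

Lemma section_comp p : in_residue 0 p -> section 0 p \Po 'X^(m.+1) = p.
Proof.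
move=> D; apply/polyP=> l; rewrite coef_comp_poly_Xn // coef_section addn0.
case: ifPn => [dl|ndl]; first by rewrite mulnC divnK.
by rewrite D //; apply: contra ndl => /eqP/(congr1 val) /= /eqP; rewrite mod0n.
Qed.

Lemma size_cnorm e p : (size p <= e.+1)%N -> (size (cnorm p) <= (m.+1 * e).+1)%N.
Proof.
move=> sp; rewrite mulnC; apply: size_det_poly => i j; rewrite mxE.
exact: leq_trans (size_residue_part _ _) sp.
Qed.

(** The minors along the first column have size [m]; this form yields the degree bounds and the
    behaviour under ring morphisms. *)
Lemma cofactor_sumE p : cofactor_sum p =
  \sum_j (-1) ^+ (j : 'I_m.+1) * \det (row' j (col' 0 (circulant p))).
Proof.
by rewrite /cofactor_sum mxE; apply: eq_bigr => j _;
  rewrite !mxE mulr1 /cofactor /= addn0.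
Qed.

Lemma size_cofactor_sum e p :
  (size p <= e.+1)%N -> (size (cofactor_sum p) <= (m * e).+1)%N.
Proof.
move=> sp; rewrite cofactor_sumE; apply: leq_trans (size_sum _ _ _) _.
apply/bigmax_leqP => j _.
rewrite -signr_odd; set M := row' _ _.
have: (size (\det M) <= (m * e).+1)%N.
  rewrite mulnC; apply: size_det_poly => i l; rewrite !mxE.
  exact: leq_trans (size_residue_part _ _) sp.
by case: (odd _); rewrite ?expr1 ?expr0 ?mulN1r ?mul1r ?size_polyN.
Qed.

Definition rot_sign (e : nat) : bool := perm (addIr (inZp e : 'I_m.+1)).

(** The coefficient of degree e sits only in the entries with j - i = e, so the matrix of top
    coefficients is p_e times the permutation matrix of a cyclic shift. *)
Lemma cnorm_top e p : (size p <= e.+1)%N ->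
  (cnorm p)`_(m.+1 * e) = (-1) ^+ rot_sign e * p`_e ^+ m.+1.
Proof.
move=> sp; rewrite mulnC coef_det_top => [|i j]; last first.
  by rewrite mxE; apply: leq_trans (size_residue_part _ _) sp.
rewrite -det_perm mulrC -detZ; congr (\det _).
apply/matrixP=> i j; rewrite !mxE coef_residue_part permE.
by rewrite eq_sym subr_eq [inZp e + i]addrC eq_sym; case: eqP;
  rewrite ?mulr1 ?mulr0.
Qed.

Lemma cnorm_coef0 p : (cnorm p)`_0 = p`_0 ^+ m.+1.
Proof.
rewrite -horner_coef0 -[LHS]/(horner_eval 0 _) -det_map_mx -det_scalar.
congr (\det _); apply/matrixP=> i j; rewrite !mxE /= horner_evalE horner_coef0.
rewrite coef_residue_part;
by rewrite inZp0 eq_sym subr_eq0 eq_sym; case: eqP.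
Qed.

End Circulant.

Section CirculantMap.

Variables (R S : comNzRingType) (f : {rmorphism R -> S}) (m : nat).
Implicit Types (p : {poly R}).

Lemma map_circulant p :
  map_mx (map_poly f) (circulant m p) = circulant m (map_poly f p).
Proof.
apply/matrixP=> i j; rewrite !mxE; apply/polyP=> l.
rewrite coef_map !coef_residue_part coef_map.
by case: ifP => _; [exact: erefl | exact: raddf0].
Qed.

Lemma map_cnorm p : map_poly f (cnorm m p) = cnorm m (map_poly f p).
Proof. by rewrite /cnorm -map_circulant det_map_mx. Qed.

Lemma map_cofactor_sum p :
  map_poly f (cofactor_sum m p) = cofactor_sum m (map_poly f p).
Proof.
rewrite !cofactor_sumE rmorph_sum; apply: eq_bigr => j _.
by rewrite rmorphM rmorph_sign -det_map_mx map_row' map_col' map_circulant.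
Qed.

Lemma map_section k p : map_poly f (section m k p) = section m k (map_poly f p).
Proof. by apply/polyP=> l; rewrite coef_map !coef_section coef_map. Qed.

End CirculantMap.

(** * The Landen transform in coordinates *)

Section BinaryForms.

Variables (R : comNzRingType) (d : nat).
Implicit Types (a : 'rV[R]_d.+1) (p : {poly R}).

(** The polynomial [form_poly], over a commutative ring so that it also applies to the row of
    indeterminates. *)
Definition binpoly a : {poly R} := \sum_(i < d.+1) a 0 i *: 'X^(d - i).

Definition coefrow p : 'rV[R]_d.+1 := \row_i p`_(d - i).

Lemma coef_binpoly a (i : 'I_d.+1) : (binpoly a)`_(d - i) = a 0 i.
Proof.
rewrite /binpoly coef_sum (bigD1 i) //= coefZ coefXn eqxx mulr1.
rewrite big1 ?addr0 // => j ji; rewrite coefZ coefXn.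
case: eqP => [dij|]; last by rewrite mulr0.
by case/eqP: ji; apply: val_inj; rewrite /= -[val j](subKn (leq_ord j)) -dij
  subKn // leq_ord.
Qed.

Lemma size_binpoly a : (size (binpoly a) <= d.+1)%N.
Proof.
apply: leq_trans (size_sum _ _ _) _; apply/bigmax_leqP => i _.
by apply: leq_trans (size_scale_leq _ _) _; rewrite size_polyXn ltnS leq_subr.
Qed.

Lemma binpolyK : cancel binpoly coefrow.
Proof. by move=> a; apply/rowP=> i; rewrite mxE coef_binpoly. Qed.

Lemma coefrowK p : (size p <= d.+1)%N -> binpoly (coefrow p) = p.
Proof.
move=> sp; apply/polyP=> l; case: (leqP l d) => ld.
  have := coef_binpoly (coefrow p) (inord (d - l)).
  by rewrite mxE inordK ?ltnS ?leq_subr // subKn.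
rewrite !nth_default //; first exact: leq_trans sp _.
exact: leq_trans (size_binpoly _) _.
Qed.

Lemma binpoly0 : binpoly 0 = 0.
Proof. by rewrite /binpoly big1 // => i _; rewrite mxE scale0r. Qed.

Lemma coef_binpoly_d a : (binpoly a)`_d = a 0 ord0.
Proof. by have := coef_binpoly a ord0; rewrite subn0. Qed.

Lemma coef_binpoly_0 a : (binpoly a)`_0 = a 0 ord_max.
Proof. by have := coef_binpoly a ord_max; rewrite subnn. Qed.

Lemma size_binpoly_lead0 a : a 0 ord0 = 0 -> (size (binpoly a) <= d)%N.
Proof.
move=> a0; have := size_binpoly a; rewrite leq_eqVlt => /orP[/eqP sa|//].
have /eqP : lead_coef (binpoly a) = 0 by rewrite lead_coefE sa /= coef_binpoly_d.
by rewrite lead_coef_eq0 => /eqP ->; rewrite size_poly0.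
Qed.

End BinaryForms.

Lemma map_binpoly (R S : comNzRingType)
    (f : {rmorphism R -> S}) d (a : 'rV[R]_d.+1) :
  map_poly f (binpoly a) = binpoly (map_mx f a).
Proof.
rewrite /binpoly rmorph_sum; apply: eq_bigr => i _ /=.
by rewrite linearZ /= map_polyXn mxE.
Qed.

Lemma map_coefrow (R S : comNzRingType) (f : {rmorphism R -> S}) d (p : {poly R}) :
  map_mx f (coefrow d p) = coefrow d (map_poly f p).
Proof. by apply/rowP=> i; rewrite !mxE coef_map. Qed.

Section LandenVector.

Variables (R : comNzRingType) (m k d : nat).
Implicit Types x : 'rV[R]_(d.+1 + d.+1).

(** Numerator of phi over the denominator [cnorm], which only involves powers of w^(m+1). *)
Definition landen_aux x : {poly R} :=
  binpoly (lsubmx x) * cofactor_sum m (binpoly (rsubmx x)).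

Definition landen_num x : {poly R} := section m k (landen_aux x).

Definition landen_den x : {poly R} := section m 0 (cnorm m (binpoly (rsubmx x))).

(** The coordinates of the map as one formula over any ring. The size bounds on [landen_num] and
    [landen_den] below show that [coefrow] truncates nothing. *)
Definition landen_vec x : 'rV[R]_(d.+1 + d.+1) :=
  row_mx (coefrow d (landen_num x)) (coefrow d (landen_den x)).

Lemma size_section e (p : {poly R}) :
  (size p <= m.+1 * e + k)%N -> (size (section m k p) <= e)%N.
Proof.
move=> sp; apply/leq_sizeP => l el; rewrite coef_section nth_default //.
by apply: leq_trans sp _; rewrite leq_add2r leq_mul2l el orbT.
Qed.

Lemma size_landen_aux e x : (size (binpoly (lsubmx x)) <= e.+1)%N ->
  (size (landen_aux x) <= (e + m * d).+1)%N.
Proof.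
by move=> sa; apply: size_mul_bound => //; apply/size_cofactor_sum/size_binpoly.
Qed.

Lemma size_landen_num x : (size (landen_num x) <= d.+1)%N.
Proof.
apply: size_section; apply: leq_trans (size_landen_aux (size_binpoly _)) _.
by rewrite mulnS -mulSn -addnA addSnnS (leq_trans _ (leq_addl _ _)) // ltnS
  leq_addr.
Qed.

(** The numerator A H has degree at most (m+1)d, and less if a_0 = 0, while the coefficient of z^d
    is read at exponent (m+1)d + k. *)
Lemma size_landen_num_lead0 x :
  (0 < k)%N \/ lsubmx x 0 ord0 = 0 -> (size (landen_num x) <= d)%N.
Proof.
move=> H; apply: size_section; case: H => [k0|a0].
  apply: leq_trans (size_landen_aux (size_binpoly _)) _.
  by rewrite -mulSn -addn1 leq_add2l.
have := size_binpoly_lead0 a0; rewrite /landen_aux.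
(* For [d = 0] the polynomial A is zero; otherwise its degree is at most [e]. *)
case: d x a0 => [|e] x a0 sa.
  by move: sa; rewrite leqn0 size_poly_eq0 => /eqP->; rewrite mul0r size_poly0.
apply: leq_trans (size_mul_bound sa (size_cofactor_sum _ (size_binpoly _))) _.
by rewrite -addSn -mulSn leq_addr.
Qed.

Lemma size_landen_den x : (size (landen_den x) <= d.+1)%N.
Proof.
apply/leq_sizeP => l dl; rewrite coef_section nth_default //.
apply: leq_trans (size_cnorm _ (size_binpoly _)) _.
by rewrite addn0 ltn_pmul2l.
Qed.

Lemma landen_den_comp x :
  landen_den x \Po 'X^(m.+1) = cnorm m (binpoly (rsubmx x)).
Proof. by rewrite section_comp //; apply: in_residue_cnorm. Qed.

Lemma binpoly_landen_num x : binpoly (lsubmx (landen_vec x)) = landen_num x.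
Proof. by rewrite row_mxKl coefrowK // size_landen_num. Qed.

Lemma binpoly_landen_den x : binpoly (rsubmx (landen_vec x)) = landen_den x.
Proof. by rewrite row_mxKr coefrowK // size_landen_den. Qed.

Lemma landen_vec_b0 x : landen_vec x 0 (rshift _ ord0) =
  (-1) ^+ rot_sign m d * x 0 (rshift _ ord0) ^+ m.+1.
Proof.
rewrite row_mxEr mxE subn0 coef_section addn0 cnorm_top ?size_binpoly //.
by rewrite coef_binpoly_d mxE.
Qed.

Lemma landen_vec_bd x : landen_vec x 0 (rshift _ ord_max) =
  x 0 (rshift _ ord_max) ^+ m.+1.
Proof.
by rewrite row_mxEr mxE subnn coef_section muln0 cnorm_coef0 coef_binpoly_0 mxE.
Qed.

Lemma landen_vec_a0 x : (0 < k)%N \/ lsubmx x 0 ord0 = 0 ->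
  lsubmx (landen_vec x) 0 ord0 = 0.
Proof.
move=> H; rewrite row_mxKl mxE subn0 nth_default //.
exact: size_landen_num_lead0.
Qed.

(** The minors of a zero circulant have size [m], so they vanish when [m] is positive; for [m = 0]
    the empty minor is 1 and the numerator survives. *)
Lemma landen_vec_b_zero x : (0 < m)%N -> rsubmx x = 0 -> landen_vec x = 0.
Proof.
move=> m0 b0; rewrite /landen_vec /landen_num /landen_den /landen_aux b0 binpoly0.
have circ0 : circulant m 0 = 0 :> 'M[{poly R}]_m.+1.
  by apply/matrixP=> i j; rewrite !mxE; apply/polyP=> l;
     rewrite coef_residue_part !coef0 if_same.
have -> : cofactor_sum m 0 = 0 :> {poly R}.
  rewrite cofactor_sumE circ0 big1 // => j _.
  case: m m0 j => // m' _ j; rewrite (_ : row' _ _ = 0) ?det0 ?mulr0 //.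
  by apply/matrixP=> i l; rewrite !mxE.
rewrite /cnorm circ0 det0 mulr0.
have sec0 l : section m l 0 = 0 :> {poly R}.
  by apply/polyP=> i; rewrite coef_section !coef0.
rewrite !sec0; have -> : coefrow d 0 = 0 :> 'rV[R]_d.+1.
  by apply/rowP=> i; rewrite !mxE coef0.
exact: row_mx0.
Qed.

End LandenVector.

(** Specialising the vector of integral forms at a point gives the vector computed over the field of
    that point. *)
Lemma map_landen_vec (R S : comNzRingType) (f : {rmorphism R -> S}) m k d
    (x : 'rV[R]_(d.+1 + d.+1)) :
  map_mx f (landen_vec m k x) = landen_vec m k (map_mx f x).
Proof.
rewrite /landen_vec map_row_mx !map_coefrow;
  congr (row_mx (coefrow d _) (coefrow d _)).
  rewrite /landen_num map_section /landen_aux rmorphM /= map_cofactor_sum.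
  by rewrite !map_binpoly map_lsubmx map_rsubmx.
by rewrite /landen_den map_section map_cnorm map_binpoly map_rsubmx.
Qed.

(** * Integral polynomials and rational maps *)

Section Evaluation.

Variables (n : nat) (S : comNzRingType).

Definition gen_row : 'rV[{mpoly int[n]}]_n := \row_i 'X_i.

Definition mp_eval (x : 'rV[S]_n) : {rmorphism {mpoly int[n]} -> S} :=
  mmap intr (x 0).

Lemma mp_evalX (x : 'rV[S]_n) i : mp_eval x 'X_i = x 0 i.
Proof. by rewrite /= mmapX mmap1U. Qed.

Lemma map_gen_row (x : 'rV[S]_n) : map_mx (mp_eval x) gen_row = x.
Proof. by apply/rowP=> i; rewrite !mxE mp_evalX. Qed.

End Evaluation.

Lemma rmorph_mp_eval n (S T : comNzRingType)
    (f : {rmorphism S -> T}) (x : 'rV[S]_n) p :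
  f (mp_eval x p) = mp_eval (map_mx f x) p.
Proof.
rewrite /= /mmap rmorph_sum; apply: eq_bigr => t _.
rewrite rmorphM rmorph_int; congr (_ * _).
rewrite rmorph_prod; apply: eq_bigr => i _.
by rewrite rmorphXn mxE.
Qed.

Lemma mpoly_atE n (K : fieldType) (p : {mpoly int[n]}) (x : 'rV[K]_n) :
  mpoly_at p x = mp_eval x p.
Proof. by []. Qed.

Lemma base_expansion_inj n D (a b : 'I_n -> nat) :
  (forall i, a i < D)%N -> (forall i, b i < D)%N ->
  (\sum_i a i * D ^ i = \sum_i b i * D ^ i)%N -> a =1 b.
Proof.
elim: n a b => [|n IH] a b aD bD; first by move=> _ [].
have D0 : (0 < D)%N by apply: leq_ltn_trans (aD ord0).
have split_low (c : 'I_n.+1 -> nat) :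
    (\sum_i c i * D ^ i = (\sum_(i < n) c (lift ord0 i) * D ^ i) * D + c ord0)%N.
  rewrite big_ord_recl muln1 addnC; congr (_ + _)%N.
  by rewrite big_distrl; apply: eq_bigr => i _; rewrite /= -mulnA -expnSr.
rewrite !split_low => E.
have E0 : a ord0 = b ord0.
  by have := congr1 (modn^~ D) E; rewrite !modnMDl !modn_small.
have E1 := congr1 (divn^~ D) E; move: E1.
rewrite /= !divnMDl // !divn_small // !addn0 => E1.
have {}IH := IH _ _ (fun i => aD _) (fun i => bD _) E1.
by move=> i; case: (unliftP ord0 i) => [j|] ->; rewrite ?E0 // IH.
Qed.

Lemma mpoly_eq0_alg n (p : {mpoly int[n]}) :
  (forall x : 'rV[algC]_n, mpoly_at p x = 0) -> p = 0.
Proof.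
(* Kronecker substitution: x_i = t^(D^i) is injective on monomials whose
   exponents are all smaller than D. *)
move=> p0; pose D := msize p.
pose e (t : 'X_{1..n}) := (\sum_i t i * D ^ i)%N.
pose P : {poly algC} := \sum_(t <- msupp p) (p@_t)%:~R *: 'X^(e t).
have PE : P = 0.
  apply/eqP/negPn/negP => P0.
  have := @max_poly_roots _ P [seq i%:R | i <- iota 0 (size P)] P0.
  rewrite size_map size_iota ltnn => H; apply: notF; apply: H.
    apply/allP=> _ /mapP[i _ ->].
    have := p0 (\row_j i%:R ^+ (D ^ j)); rewrite /mpoly_at /mmap => H0.
    rewrite rootE /P horner_sum -[X in _ == X]H0; apply/eqP/eq_bigr => t _.
    rewrite hornerZ hornerXn; congr (_ * _).
    rewrite /mmap1 /e -prodrXr; apply: eq_bigr => j _.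
    by rewrite mxE -exprM mulnC.
  by rewrite map_inj_uniq ?iota_uniq // => a b /eqP;
    rewrite Num.Theory.eqr_nat => /eqP.
apply/mpolyP=> t; rewrite mcoeff0; apply/eqP; rewrite mcoeff_eq0; apply/negP=> tp.
(* Among the monomials of p only t is sent to the exponent [e t], so this coefficient of P is that
   of p at t. *)
have := congr1 (fun q : {poly algC} => q`_(e t)) PE; rewrite /P coef_sum coef0.
rewrite (big_rem t) //= coefZ coefXn eqxx mulr1 big1_seq ?addr0 /=.
  by move/eqP; rewrite intr_eq0 mcoeff_eq0 tp.
move=> s; rewrite mem_rem_uniq ?msupp_uniq // inE => /andP[st sp].
rewrite coefZ coefXn; case: eqP => [E|]; last by rewrite mulr0.
case/eqP: st; apply/esym/mnmP; apply: (@base_expansion_inj n D) => //.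
  by move=> i; apply: leq_ltn_trans (msize_mdeg_lt tp);
    rewrite mdegE (bigD1 i) ?leq_addr.
by move=> i; apply: leq_ltn_trans (msize_mdeg_lt sp);
  rewrite mdegE (bigD1 i) ?leq_addr.
Qed.

(** A monomial t of p gives u + t in the support of ['X_[v] * q], hence v <= u + t; where v is
    nonzero u vanishes, so v <= t. *)
Lemma mpolyX_dvd_disjoint n (u v : 'X_{1..n}) (p q : {mpoly int[n]}) :
  (forall i, u i = 0%N \/ v i = 0%N) -> 'X_[u] * p = 'X_[v] * q ->
  exists h, p = 'X_[v] * h.
Proof.
move=> uv E.
have vp t : t \in msupp p -> (v <= t)%MM.
  move=> tp; have: (u + t)%MM \in msupp (p * 'X_[u]).
    by rewrite mcoeff_msupp mcoeffMX -mcoeff_msupp.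
  rewrite mulrC E mulrC (perm_mem (msuppMX _ _)) => /mapP[s _ /mnmP ts].
  apply/mnm_lepP=> i; case: (uv i) => [ui|->] //.
  by move: (ts i); rewrite !mnmDE ui add0n => ->; rewrite leq_addr.
exists (\sum_(t <- msupp p) p@_t *: 'X_[t - v]).
rewrite {1}[p]mpolyE mulr_sumr; apply: eq_big_seq => t /vp vt.
by rewrite -scalerAr -mpolyXD addmC submK.
Qed.

Lemma mpolyX_neq0 n (u : 'X_{1..n}) : ('X_[u] : {mpoly int[n]}) != 0.
Proof.
by apply/negP=> /eqP/mpolyP/(_ u); rewrite mcoeffX eqxx mcoeff0.
Qed.

(** * Rational maps and their reduced representatives *)

Section RationalMaps.

Variables (n r : nat).
Implicit Types f g h : ratmap n r.

Lemma ratmap_eq_refl f : ratmap_eq f f.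
Proof. by move=> i j; rewrite mulrC. Qed.

Lemma ratmap_eq_sym f g : ratmap_eq f g -> ratmap_eq g f.
Proof. by move=> fg i j; rewrite mulrC -fg mulrC. Qed.

Lemma ratmap_eq_trans f g h : ratmap_eq f g -> ratmap_eq g h -> ratmap_eq f h.
Proof.
move=> fg gh i j; case: (rm_neq0 g) => l gl; apply: (mulIf gl).
by rewrite -mulrA [h j * _]mulrC gh mulrA fg -mulrA gh mulrA mulrAC.
Qed.

Lemma defined_at_eq f g (K : fieldType) (x : 'rV[K]_n) :
  ratmap_eq f g -> defined_at f x -> defined_at g x.
Proof.
move=> /ratmap_eq_sym gf [h fh hx]; exists h => //; exact: ratmap_eq_trans fh.
Qed.

Lemma maps_to_eq f g (K : fieldType) (x : 'rV[K]_n) (y : 'rV[K]_r) :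
  ratmap_eq f g -> maps_to f x y -> maps_to g x y.
Proof.
move=> /ratmap_eq_sym gf [h fh hx]; exists h => //; exact: ratmap_eq_trans fh.
Qed.

(** Absence of a common factor, in the form needed: every representative is a polynomial multiple of
    [f], so [f] alone decides where the map is defined. *)
Definition reduced f := forall g, ratmap_eq f g ->
  exists q, forall i, g i = q * f i.

(** From f_i g_j = f_j g_i and the coprimality of the two monomials, f_j divides g_j; the quotient
    then serves for every coordinate. *)
Lemma reduced_monomials f (s : bool) (u v : 'X_{1..n}) (i j : 'I_r) :
  (forall l, u l = 0%N \/ v l = 0%N) ->
  f i = (-1) ^+ s * 'X_[u] -> f j = 'X_[v] -> reduced f.
Proof.
move=> uv fi fj g fg; have := fg i j; rewrite fi fj => E.
have [q qE] : exists q, (-1) ^+ s * g j = 'X_[v] * q.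
  by apply: (mpolyX_dvd_disjoint uv (q := g i)); rewrite -E mulrCA mulrA.
exists ((-1) ^+ s * q) => l; have fj0 : f j != 0.
  by rewrite fj mpolyX_neq0.
apply: (mulfI fj0); rewrite -fg.
have -> : g j = (-1) ^+ s * ('X_[v] * q) by rewrite -qE mulrA -expr2 sqrr_sign
  mul1r.
by rewrite -fj; ring.
Qed.

Lemma reduced_at f g (K : fieldType) (x : 'rV[K]_n) : reduced f -> ratmap_eq f g ->
  exists c, ratmap_at g x = c *: ratmap_at f x.
Proof.
move=> redf /redf[q gE]; exists (mp_eval x q); apply/rowP=> i.
by rewrite !mxE !mpoly_atE gE rmorphM.
Qed.

Lemma reduced_defined_at f (K : fieldType) (x : 'rV[K]_n) :
  reduced f -> defined_at f x <-> ratmap_at f x != 0.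
Proof.
move=> redf; split=> [[g /(reduced_at x redf)[c ->]]|fx]; last first.
  by exists f => //; apply: ratmap_eq_refl.
by apply: contraNneq => ->; rewrite scaler0.
Qed.

Lemma reduced_maps_to f (K : fieldType) (x : 'rV[K]_n) (y : 'rV[K]_r) :
  reduced f -> maps_to f x y <-> ratmap_at f x != 0 /\ proj_eq (ratmap_at f x) y.
Proof.
move=> redf; split=> [[g fg [gx [c c0 ->]]]|fx]; last first.
  by exists f => //; apply: ratmap_eq_refl.
have [c' gE] := reduced_at x redf fg; move: gx; rewrite gE scaler_eq0 negb_or.
by move=> /andP[c'0 fx]; split=> //; exists (c * c'); rewrite ?mulf_neq0 // scalerA.
Qed.

Lemma reduced_algebraic_degree f g :
  reduced f -> ratmap_eq g f -> algebraic_degree g (rm_deg f).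
Proof.
move=> redf gf; exists f; split=> // K x _ gx.
by apply/(reduced_defined_at x redf); apply: defined_at_eq gx.
Qed.

End RationalMaps.

(** * Homogeneity of the coordinates *)

Section HomogeneousCoefficients.

Variable n : nat.
Implicit Types p q : {poly {mpoly int[n]}}.

Definition homog_coefs (e : nat) p := forall l, p`_l \is e.-homog.

Lemma homog_coefs0 e : homog_coefs e 0.
Proof. by move=> l; rewrite coef0 dhomog0. Qed.

Lemma homog_coefsD e p q : homog_coefs e p -> homog_coefs e q ->
  homog_coefs e (p + q).
Proof. by move=> hp hq l; rewrite coefD dhomogD. Qed.

Lemma homog_coefsN e p : homog_coefs e p -> homog_coefs e (- p).
Proof. by move=> hp l; rewrite coefN dhomogN. Qed.

Lemma homog_coefs1 : homog_coefs 0 1.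
Proof. by move=> [|l]; rewrite coef1 ?dhomog1 ?dhomog0. Qed.

Lemma homog_coefsM a b p q :
  homog_coefs a p -> homog_coefs b q -> homog_coefs (a + b) (p * q).
Proof.
by move=> hp hq l; rewrite coefM rpred_sum // => i _; apply: dhomogM.
Qed.

Lemma homog_coefs_det e k (M : 'M[{poly {mpoly int[n]}}]_k) :
  (forall i j, homog_coefs e (M i j)) -> homog_coefs (e * k) (\det M).
Proof.
apply: (@graded_det_const _ homog_coefs).
- exact: homog_coefs0.
- exact: homog_coefsD.
- exact: homog_coefsN.
- exact: homog_coefs1.
- exact: homog_coefsM.
Qed.

Lemma homog_coefs_circulant e m p i j :
  homog_coefs e p -> homog_coefs e (circulant m p i j).
Proof.
by move=> hp l; rewrite mxE coef_residue_part; case: ifP; rewrite ?dhomog0.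
Qed.

Lemma homog_coefs_cnorm e m p : homog_coefs e p ->
  homog_coefs (e * m.+1) (cnorm m p).
Proof. by move=> hp; apply: homog_coefs_det => i j;
  apply: homog_coefs_circulant. Qed.

Lemma homog_coefs_cofactor_sum e m p :
  homog_coefs e p -> homog_coefs (e * m) (cofactor_sum m p).
Proof.
move=> hp; rewrite cofactor_sumE; apply: (big_ind (homog_coefs _)).
- exact: homog_coefs0.
- exact: homog_coefsD.
move=> j _; rewrite -signr_odd -[X in homog_coefs X]add0n.
apply: homog_coefsM.
  case: (odd j); rewrite ?expr0 ?expr1; last exact: homog_coefs1.
  exact/homog_coefsN/homog_coefs1.
apply: homog_coefs_det => i l; rewrite !mxE.
have := @homog_coefs_circulant e m p (lift j i) (lift 0 l) hp.
by rewrite mxE.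
Qed.

Lemma homog_coefs_section e m k p : homog_coefs e p ->
  homog_coefs e (section m k p).
Proof. by move=> hp l; rewrite coef_section. Qed.

Lemma homog_coefs_binpoly e d (a : 'rV[{mpoly int[n]}]_d.+1) :
  (forall i, a 0 i \is e.-homog) -> homog_coefs e (binpoly a).
Proof.
move=> ha; apply: (big_ind (homog_coefs e)).
- exact: homog_coefs0.
- exact: homog_coefsD.
move=> i _ l; rewrite coefZ coefXn; case: eqP => _.
  by rewrite mulr1; apply: ha.
by rewrite mulr0; apply: dhomog0.
Qed.

(** The numerator has degree 1 from A plus m from H; the norm is a determinant of size m+1 with
    entries of degree 1. *)
Lemma homog_landen_vec m k d (x : 'rV[{mpoly int[n]}]_(d.+1 + d.+1)) :
  (forall i, x 0 i \is 1.-homog) ->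
  forall i, landen_vec m k x 0 i \is m.+1.-homog.
Proof.
move=> hx; have hA := homog_coefs_binpoly (a := lsubmx x) (e := 1).
have hB : homog_coefs 1 (binpoly (rsubmx x)).
  by apply: homog_coefs_binpoly => i; rewrite mxE.
have {}hA : homog_coefs 1 (binpoly (lsubmx x)) by apply: hA => i; rewrite mxE.
move=> i; case: (split_ordP i) => j ->; rewrite ?row_mxEl ?row_mxEr mxE.
  rewrite -[m.+1]add1n -[X in (1 + X).-homog]mul1n.
  by apply/homog_coefs_section/homog_coefsM => //; apply: homog_coefs_cofactor_sum.
by rewrite -[m.+1]mul1n; apply/homog_coefs_section/homog_coefs_cnorm.
Qed.

End HomogeneousCoefficients.

Lemma gen_row_homog n i : gen_row n 0 i \is 1.-homog.
Proof. by rewrite mxE dhomogX /= mdeg1. Qed.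

(** * The rational map given by the Landen vector *)

Section LandenMap.

Variables (m k d : nat).
Local Notation n := (d.+1 + d.+1)%N.

Definition landen_coord (i : 'I_n) : {mpoly int[n]} :=
  landen_vec m k (gen_row n) 0 i.

Lemma landen_coord_homog i : landen_coord i \is m.+1.-homog.
Proof. exact/homog_landen_vec/gen_row_homog. Qed.

Lemma mpolyUX (i : 'I_n) : ('X_i : {mpoly int[n]}) ^+ m.+1 = 'X_[U_(i) *+ m.+1].
Proof. by rewrite mpolyXn. Qed.

Lemma landen_coord_b0 :
  landen_coord (rshift _ ord0) =
  (-1) ^+ rot_sign m d * 'X_[U_(rshift _ ord0) *+ m.+1].
Proof. by rewrite /landen_coord landen_vec_b0 mxE mpolyUX. Qed.

Lemma landen_coord_bd :
  landen_coord (rshift _ ord_max) = 'X_[U_(rshift _ ord_max) *+ m.+1].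
Proof. by rewrite /landen_coord landen_vec_bd mxE mpolyUX. Qed.

Lemma landen_coord_neq0 : exists i, landen_coord i != 0.
Proof. by exists (rshift _ ord_max); rewrite landen_coord_bd mpolyX_neq0. Qed.

Definition landen_map : ratmap n n := RatMap landen_coord_homog landen_coord_neq0.

Lemma landen_map_at (K : fieldType) (x : 'rV[K]_n) :
  ratmap_at landen_map x = landen_vec m k x.
Proof.
rewrite -{2}[x]map_gen_row -map_landen_vec.
by apply/rowP=> i; rewrite [LHS]mxE [RHS]mxE.
Qed.

(** The coordinates b_0 and b_d of the image are, up to sign, powers of two variables, distinct
    because d > 0. *)
Lemma landen_map_reduced : (0 < d)%N -> reduced landen_map.
Proof.
move=> d0; apply: (@reduced_monomials _ _ landen_map _ _ _ _ _ _ landen_coord_b0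
  landen_coord_bd) => l.
rewrite !mulmnE !mnm1E; case: eqP => [<-|]; last by left.
by right; case: eqP => // /rshift_inj/(congr1 val) /= E; rewrite E in d0.
Qed.

End LandenMap.

(** * Rational functions and the Landen transform *)

Local Notation tofrac := FracField.tofrac.

Lemma frac_numden (R : idomainType) (f : {fraction R}) :
  f * tofrac \d_(repr f) = tofrac \n_(repr f).
Proof.
rewrite -{1}[f]reprK; unlock FracField.tofrac.
rewrite -[LHS]FracField.pi_mul; apply/eqmodP; rewrite /= FracField.equivfE.
rewrite /FracField.mulf !numden_Ratio ?mulf_neq0 ?oner_neq0 ?denom_ratioP //.
by rewrite !mulr1 mulrC.
Qed.

Lemma frac_eq_div (R : idomainType) (f : {fraction R}) :
  f = tofrac \n_(repr f) / tofrac \d_(repr f).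
Proof. by rewrite -frac_numden mulfK // tofrac_eq0 denom_ratioP. Qed.

Lemma tofrac_div_eq (R : idomainType) (p q p' q' : R) : q != 0 -> q' != 0 ->
  (tofrac p / tofrac q == tofrac p' / tofrac q') = (p * q' == p' * q).
Proof.
by move=> q0 q'0; rewrite eqr_div ?tofrac_eq0 // -!tofracM tofrac_eq.
Qed.

Lemma frac_repr_cross (R : idomainType) (p q : R) : q != 0 ->
  \n_(repr (tofrac p / tofrac q)) * q = p * \d_(repr (tofrac p / tofrac q)).
Proof.
move=> q0; apply/eqP; rewrite -tofrac_div_eq ?denom_ratioP //.
by rewrite -frac_eq_div.
Qed.

Section Composition.

Variables (K L : fieldType) (iota : {rmorphism K -> L}).
Implicit Types (p q : {poly K}) (g : {poly L}).

Lemma horner_ratC p g :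
  (map_poly (fun c => ratC (iota c)) p).[tofrac g] = tofrac (map_poly iota p \Po g).
Proof.
rewrite /comp_poly -horner_map /= -!map_poly_comp; congr (_.[_]).
Qed.

Lemma map_comp_poly_neq0 p g : (1 < size g)%N -> p != 0 ->
  map_poly iota p \Po g != 0.
Proof. by move=> sg p0; rewrite comp_poly_eq0 // map_poly_eq0. Qed.

(** Substituting a nonconstant g keeps denominators nonzero, so cross-multiplication shows that the
    chosen representative does not matter. *)
Lemma ratcomp_div p q g : (1 < size g)%N -> q != 0 ->
  ratcomp iota (tofrac p / tofrac q) (tofrac g) =
  tofrac (map_poly iota p \Po g) / tofrac (map_poly iota q \Po g).
Proof.
move=> sg q0; rewrite /ratcomp !horner_ratC; apply/eqP.
rewrite tofrac_div_eq ?map_comp_poly_neq0 ?denom_ratioP //.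
by rewrite -!comp_polyM -!rmorphM frac_repr_cross.
Qed.

(** Substituting a nonconstant polynomial is injective on polynomials; this makes the Landen
    transform unique. *)
Lemma ratcomp_inj (f f' : ratfun K) g : (1 < size g)%N ->
  ratcomp iota f (tofrac g) = ratcomp iota f' (tofrac g) -> f = f'.
Proof.
move=> sg; rewrite (frac_eq_div f) (frac_eq_div f') !ratcomp_div ?denom_ratioP //.
move/eqP; rewrite tofrac_div_eq ?map_comp_poly_neq0 ?denom_ratioP //.
rewrite -!comp_polyM -!rmorphM -subr_eq0 -rmorphB /= -raddfB.
rewrite comp_poly_eq0 // map_poly_eq0 subr_eq0 => E.
by apply/eqP; rewrite tofrac_div_eq ?denom_ratioP.
Qed.

End Composition.

Lemma is_landen_unique (K L : fieldType) (iota : {rmorphism K -> L}) zeta m k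
    (phi psi psi' : ratfun K) :
  is_landen iota zeta m.+1 k phi psi -> is_landen iota zeta m.+1 k phi psi' ->
  psi = psi'.
Proof.
rewrite /is_landen /ratX -!tofracXn => <-.
by move=> /esym; apply: ratcomp_inj; rewrite size_polyXn.
Qed.

(** Two coprime pairs representing the same fraction are associate term by term, so their sizes
    agree. *)
Lemma ratdeg_div (K : fieldType) (p q : {poly K}) : q != 0 ->
  ratdeg (tofrac p / tofrac q) =
  (maxn (size (p %/ gcdp p q)) (size (q %/ gcdp p q))).-1.
Proof.
move=> q0; rewrite /ratdeg; move: (frac_repr_cross p q0).
set n := \n__; set d := \d__ => E.
have d0 : d != 0 by apply: denom_ratioP.
clearbody n d.
have cancel_gcd (a b a' b' : {poly K}) : b != 0 -> b' != 0 -> a * b' = a' * b ->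
    a %/ gcdp a b * (b' %/ gcdp a' b') = a' %/ gcdp a' b' * (b %/ gcdp a b).
  move=> b0 b'0 ab.
  have g0 : gcdp a b * gcdp a' b' != 0.
    by rewrite mulf_neq0 // gcdp_eq0 negb_and ?b0 ?b'0 orbT.
  apply: (mulIf g0).
  transitivity ((a %/ gcdp a b * gcdp a b) * (b' %/ gcdp a' b' * gcdp a' b')).
    by ring.
  transitivity ((a' %/ gcdp a' b' * gcdp a' b') * (b %/ gcdp a b * gcdp a b)).
    by rewrite !divpK ?dvdp_gcdl ?dvdp_gcdr.
  by ring.
have cop (a b : {poly K}) : b != 0 -> coprimep (a %/ gcdp a b) (b %/ gcdp a b).
  by move=> b0; apply: coprimep_div_gcd; rewrite b0 orbT.
move: (cop n d d0) (cop p q q0) (cancel_gcd _ _ _ _ d0 q0 E) => {E}.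
set n' := n %/ _; set d' := d %/ _; set p' := p %/ _; set q' := q %/ _.
move=> cnd cpq E; have /eqp_size-> : n' %= p'.
  rewrite /eqp -(Gauss_dvdpl p' cnd) -E dvdp_mulr //=.
  by rewrite -(Gauss_dvdpl n' cpq) E dvdp_mulr.
have /eqp_size-> // : d' %= q'.
rewrite coprimep_sym in cnd; rewrite coprimep_sym in cpq.
rewrite /eqp -(Gauss_dvdpr q' cnd) E dvdp_mull //=.
by rewrite -(Gauss_dvdpr d' cpq) -E dvdp_mull.
Qed.

Section RootsOfUnity.

Variables (L : fieldType) (zeta : L) (m : nat).
Hypothesis zetaP : m.+1.-primitive_root zeta.

Lemma zeta_neq0 : zeta != 0.
Proof. by apply/negP=> /eqP z0; have := prim_expr_order zetaP;
  rewrite z0 expr0n => /eqP; rewrite eq_sym oner_eq0. Qed.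

(** Geometric series whose ratio zeta^(l-k) is a root of unity: either the ratio is 1 or the sum
    vanishes. *)
Lemma sum_zeta (k l : nat) :
  \sum_(t < m.+1) zeta ^- (k * t) * zeta ^+ t ^+ l =
  (l == k %[mod m.+1])%:R * m.+1%:R.
Proof.
pose y := zeta ^+ l / zeta ^+ k.
transitivity (\sum_(t < m.+1) y ^+ t).
  apply: eq_bigr => t _; rewrite /y expr_div_n -!exprM mulrC.
  by rewrite [(t * l)%N]mulnC.
have y1 : (y == 1) = (l == k %[mod m.+1]).
  by rewrite -(eq_prim_root_expr zetaP) /y -[RHS](inj_eq (mulIf (invr_neq0
    (expf_neq0 k zeta_neq0)))) divff // expf_neq0 // zeta_neq0.
rewrite -y1; case: eqP => [->|/eqP y_neq1].
  by under eq_bigr do rewrite expr1n; rewrite sumr_const card_ord mul1r.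
rewrite mul0r; apply/eqP; rewrite -subr_eq0 in y_neq1.
rewrite -(mulrI_eq0 _ (mulfI y_neq1)) -subrX1 /y expr_div_n -!exprM.
by rewrite ![(_ * m.+1)%N]mulnC !exprM (prim_expr_order zetaP) !expr1n divr1 subrr.
Qed.

Lemma coef_comp_scaleX (c : L) (p : {poly L}) l :
  (p \Po (c *: 'X))`_l = p`_l * c ^+ l.
Proof.
rewrite comp_polyE coef_sum; under eq_bigr do rewrite exprZn !coefZ coefXn.
case: (ltnP l (size p)) => lp.
  rewrite (bigD1 (Ordinal lp)) //= eqxx mulr1 big1 ?addr0 // => i il.
  by rewrite [l == i]eq_sym -[i == l :> nat]/(val i == val (Ordinal lp)) val_eqE
    (negPf il) !mulr0.
rewrite nth_default // mul0r big1 // => i _.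
by rewrite gtn_eqF ?mulr0 //; apply: leq_trans lp.
Qed.

(** Summing over the rotations by roots of unity filters out the exponents not congruent to k. *)
Lemma sum_section (k : nat) (p : {poly L}) : (k < m.+1)%N ->
  \sum_(t < m.+1) zeta ^- (k * t) *: (p \Po (zeta ^+ t *: 'X)) =
  m.+1%:R * 'X^k * (section m k p \Po 'X^(m.+1)).
Proof.
move=> km; apply/polyP=> l; rewrite coef_sum.
transitivity (p`_l * ((l == k %[mod m.+1])%:R * m.+1%:R)).
  rewrite -sum_zeta mulr_sumr; apply: eq_bigr => t _.
  by rewrite coefZ coef_comp_scaleX mulrCA.
rewrite -[in RHS]mulrA [in RHS]mulr_natl coefMn mulrA mulr_natr; congr (_ *+ _).
(* An exponent l < k is not congruent to k, both being smaller than [m.+1]. *)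
rewrite coefXnM; case: ltnP => lk.
  by rewrite !modn_small ?(ltn_trans lk) // ltn_eqF // mulr0.
rewrite coef_comp_poly_Xn // eqn_mod_dvd // coef_section.
case: ifP => [dl|]; last by rewrite mulr0.
by rewrite mulr1 mulnC divnK // subnK.
Qed.

End RootsOfUnity.

Lemma cnorm_neq0 (R : idomainType) m (p : {poly R}) : p != 0 -> cnorm m p != 0.
Proof.
move=> p0; apply/negP=> /eqP N0.
have := @cnorm_top R m (size p).-1 p (leqSpred _).
rewrite N0 coef0 => /esym/eqP; rewrite mulf_eq0 signr_eq0 /= expf_eq0 /=.
by rewrite -lead_coefE lead_coef_eq0 (negPf p0).
Qed.

Lemma landen_den_neq0 (R : idomainType) m d (x : 'rV[R]_(d.+1 + d.+1)) :
  rsubmx x != 0 -> landen_den m x != 0.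
Proof.
move=> b0; apply: contraNneq b0 => N0; apply/eqP.
have := landen_den_comp m x; rewrite N0 comp_poly0 => /esym/eqP.
case: (eqVneq (binpoly (rsubmx x)) 0) => [B0 _|/(cnorm_neq0 m)/negPf->] //.
by rewrite -[LHS]binpolyK B0; apply/rowP=> i; rewrite !mxE coef0.
Qed.

Lemma binpoly_eq0 (R : comNzRingType) d (a : 'rV[R]_d.+1) :
  (binpoly a == 0) = (a == 0).
Proof.
apply/eqP/eqP => [B0|->]; last exact: binpoly0.
by rewrite -[LHS]binpolyK B0; apply/rowP=> i; rewrite !mxE coef0.
Qed.

Lemma phi_abE (K : fieldType) d (x : 'rV[K]_(d.+1 + d.+1)) :
  phi_ab x = tofrac (binpoly (lsubmx x)) / tofrac (binpoly (rsubmx x)).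
Proof. by []. Qed.

(** Over the denominator B H, a function of w^(m+1), all rotated copies of phi share one
    denominator; their numerators are then added by [sum_section]. *)
Lemma landen_vec_is_landen (K L : fieldType) (iota : {rmorphism K -> L}) zeta m k d
    (x : 'rV[K]_(d.+1 + d.+1)) :
  m.+1%:R != 0 :> K -> m.+1.-primitive_root zeta -> (k < m.+1)%N -> rsubmx x != 0 ->
  is_landen iota zeta m.+1 k (phi_ab x) (phi_ab (landen_vec m k x)).
Proof.
move=> m0 zP km b0; rewrite /is_landen !phi_abE binpoly_landen_num
  binpoly_landen_den.
have N0 := landen_den_neq0 m b0; rewrite -binpoly_eq0 in b0.
set A := binpoly (lsubmx x); set B := binpoly _ in b0 *.
rewrite /ratX -!tofracXn ratcomp_div ?size_polyXn //.
set P := landen_num m k x; set N := landen_den m x.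
pose H := map_poly iota (cofactor_sum m B).
have NE : map_poly iota N \Po 'X^(m.+1) = map_poly iota B * H.
  by rewrite -rmorphM /= mul_cofactor_sum -landen_den_comp -/N map_comp_poly
    map_polyXn.
have Nrot t : (map_poly iota B * H) \Po (zeta ^+ t *: 'X) = map_poly iota B * H.
  rewrite -NE -comp_polyA; congr (_ \Po _);
    rewrite comp_Xn_poly exprZn -exprM mulnC.
  by rewrite exprM (prim_expr_order zP) expr1n scale1r.
have BH0 : map_poly iota B * H != 0.
  by rewrite -NE map_comp_poly_neq0 // size_polyXn.
have sX t : (1 < size (zeta ^+ t *: 'X : {poly L}))%N.
  by rewrite size_scale ?size_polyX // expf_neq0 // (zeta_neq0 zP).
have term (t : 'I_m.+1) : ratC (zeta ^- (k * t)) *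
    ratcomp iota (tofrac A / tofrac B) (ratC (zeta ^+ t) * tofrac 'X) =
    tofrac (zeta ^- (k * t) *: (map_poly iota A * H \Po (zeta ^+ t *: 'X))) /
    tofrac (map_poly iota B * H).
  rewrite /ratC -tofracM mul_polyC ratcomp_div // -[X in _ = tofrac X / _]mul_polyC.
  rewrite tofracM -mulrA.
  congr (_ * _); apply/eqP; rewrite tofrac_div_eq ?map_comp_poly_neq0 //.
  by rewrite -{1}(Nrot t) -!comp_polyM; apply/eqP; congr (_ \Po _); ring.
rewrite (eq_bigr _ (fun t _ => term t)) -mulr_suml -raddf_sum /=.
rewrite (sum_section zP) //.
have -> : m.+1%:R * tofrac 'X^k = tofrac (m.+1%:R * 'X^k : {poly L}).
  by rewrite tofracM rmorph_nat.
have mX0 : tofrac (m.+1%:R * 'X^k : {poly L}) != 0.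
  rewrite tofrac_eq0 mulf_neq0 // ?expf_neq0 ?polyX_eq0 //.
  by rewrite -polyC1 -polyC_natr polyC_eq0 -(rmorph_nat iota) fmorph_eq0.
rewrite [tofrac (_ * (_ \Po _))]tofracM -NE -[_ * _ / _]mulrA mulKf //;
  congr (tofrac (_ \Po _) / _).
by rewrite /P map_section /landen_aux rmorphM.
Qed.

(** * The resultant of two binary forms *)

Section FormResultant.

(** Same matrix as [sylvester_rows], over a commutative ring, so that resultants of forms with
    indeterminate coefficients are available. *)
Definition sylvester (R : comNzRingType) d (a : 'rV[R]_d.+1) : 'M[R]_(d, d + d) :=
  \matrix_(i, j) (if (i <= j <= i + d)%N then a 0 (inord (j - i)) else 0).

Definition fresultant (R : comNzRingType) d (a b : 'rV[R]_d.+1) : R :=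
  \det (col_mx (sylvester a) (sylvester b)).

Lemma map_fresultant (R S : comNzRingType)
    (f : {rmorphism R -> S}) d (a b : 'rV[R]_d.+1) :
  f (fresultant a b) = fresultant (map_mx f a) (map_mx f b).
Proof.
rewrite /fresultant -det_map_mx map_col_mx.
by congr (\det (col_mx _ _)); apply/matrixP=> i j; rewrite !mxE;
   case: ifP; rewrite ?mxE ?rmorph0.
Qed.

Lemma form_resultantE (K : fieldType) d (a b : 'rV[K]_d.+1) :
  form_resultant a b = fresultant a b.
Proof. by []. Qed.

Lemma sylvester_row (R : comNzRingType) d (a : 'rV[R]_d.+2) (i : 'I_d.+1) :
  binpoly (row i (sylvester a) : 'rV_(d + d.+1).+1) = 'X^(d - i) * binpoly a.
Proof.
rewrite -[RHS](@coefrowK _ (d + d.+1)); last first.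
  by apply: size_mul_bound (size_binpoly a); rewrite size_polyXn ltnS leq_subr.
congr binpoly; apply/rowP=> -[j jd]; rewrite !mxE coefXnM /=.
case: i => i i_d /=.
case: (leqP j (i + d.+1)) => ji; last first.
  by rewrite andbF ifT //; lia.
have -> : (d + d.+1 - j < d - i)%N = false by apply/negbTE; lia.
rewrite andbT.
case: leqP => ij; last first.
  by rewrite nth_default //; apply: leq_trans (size_binpoly a) _; lia.
have := coef_binpoly a (inord (j - i)); rewrite inordK; last by lia.
by move=> <-; congr (_`__); lia.
Qed.

(** Turns a vector in the kernel of the Sylvester matrix into a polynomial relation u a + w b =
    0. *)
Lemma sylvester_mul (R : comNzRingType) d (a : 'rV[R]_d.+2) (u : 'rV[R]_d.+1) :
  binpoly (u *m sylvester a : 'rV_(d + d.+1).+1) = binpoly u * binpoly a.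
Proof.
rewrite mulmx_sum_row {3}/binpoly mulr_suml.
rewrite (big_morph (@binpoly R (d + d.+1)) (id1 := 0) (op1 := +%R)); first last.
- exact: binpoly0.
- move=> v w; rewrite /binpoly -big_split; apply: eq_bigr => j _ /=.
  by rewrite mxE scalerDl.
apply: eq_bigr => i _; rewrite -scalerAl -sylvester_row /binpoly scaler_sumr.
by apply: eq_bigr => j _; rewrite mxE scalerA.
Qed.

Variable K : fieldType.

(** A kernel vector gives u a = - w b with u and w too small to be nonzero multiples of a form of
    full degree; coprimality forces such a divisibility. *)
Lemma fresultant_neq0 d (a b : 'rV[K]_d.+1) :
  coprimep (binpoly a) (binpoly b) ->
  (size (binpoly a) = d.+1) \/ (size (binpoly b) = d.+1) -> fresultant a b != 0.
Proof.
case: d a b => [|d] a b cab sab; first by rewrite /fresultant det_mx00 oner_neq0.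
apply/negP => /det0P[v v0]; rewrite -[v]hsubmxK mul_row_col.
set u := lsubmx v; set w := rsubmx v => /eqP; rewrite addr_eq0 => /eqP E.
have {}E : binpoly u * binpoly a = - binpoly w * binpoly b.
  rewrite -!sylvester_mul E mulNr -sylvester_mul /binpoly -sumrN.
  by apply: eq_bigr => i _; rewrite mxE scaleNr.
have small (p q : {poly K}) : (size p <= d.+1)%N -> size q = d.+2 -> q %| p ->
  p = 0.
  move=> sp sq qp; apply/eqP; apply: contraTT qp => p0.
  by apply/negP=> /(dvdp_leq p0); rewrite sq leqNgt ltnS sp.
have sb (t : 'rV[K]_d.+1) := size_binpoly t.
have [u0 w0] : binpoly u = 0 /\ binpoly w = 0.
  case: sab => [sa|sb'].
    have w0 : binpoly w = 0.
      apply: small sa _ => //; rewrite -dvdpNr -(Gauss_dvdpl _ cab) -E.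
      by rewrite dvdp_mull.
    split=> //; move/eqP: E; rewrite w0 oppr0 mul0r mulf_eq0.
    by rewrite -[X in _ || X]size_poly_eq0 sa orbF => /eqP.
  have u0 : binpoly u = 0.
    rewrite coprimep_sym in cab.
    by apply: small sb' _ => //; rewrite -(Gauss_dvdpl _ cab) E dvdp_mull.
  split=> //; move/eqP: E; rewrite u0 mul0r eq_sym mulf_eq0 oppr_eq0.
  by rewrite -[X in _ || X]size_poly_eq0 sb' orbF => /eqP.
case/eqP: v0; rewrite -[v]hsubmxK -/u -/w.
by move/eqP: u0 w0; rewrite binpoly_eq0 => /eqP-> /eqP;
  rewrite binpoly_eq0 => /eqP ->; rewrite row_mx0.
Qed.

Lemma fresultant_root d (a b : 'rV[K]_d.+1) (g : K) : (0 < d)%N ->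
  root (binpoly a) g -> root (binpoly b) g -> fresultant a b = 0.
Proof.
case: d a b => // d a b _ /rootP ag /rootP bg.
(* Pairing a row with c evaluates its polynomial at g, so both transposed blocks kill c. *)
pose c : 'rV[K]_(d.+1 + d.+1) := \row_j g ^+ (d + d.+1 - j).
have ker (a' : 'rV[K]_d.+2) : (binpoly a').[g] = 0 -> c *m (sylvester a')^T = 0.
  move=> a'g; apply/rowP=> i; rewrite [RHS]mxE mxE.
  have := congr1 (horner^~ g) (sylvester_row a' i).
  rewrite hornerM a'g mulr0 /binpoly horner_sum => E; rewrite -[RHS]E.
  by apply: eq_bigr => j _; rewrite !mxE hornerZ hornerXn mulrC.
apply/eqP; rewrite /fresultant -det_tr; apply/det0P; exists c.
  apply/negP=> /eqP/rowP/(_ ord_max); rewrite !mxE /= subnn expr0.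
  by move/eqP; rewrite oner_eq0.
by rewrite tr_col_mx mul_mx_row !ker // row_mx0.
Qed.

Lemma fresultant_b0 d (a : 'rV[K]_d.+1) : (0 < d)%N -> fresultant a 0 = 0.
Proof.
move=> d0; apply/eqP/det0P; exists (row_mx 0 (const_mx 1)).
  apply/negP=> /eqP/rowP/(_ (rshift _ (Ordinal d0))); rewrite row_mxEr !mxE.
  by move/eqP; rewrite oner_eq0.
rewrite mul_row_col mul0mx add0r; have -> : sylvester (0 : 'rV[K]_d.+1) = 0.
  by apply/matrixP=> i j; rewrite !mxE if_same.
by rewrite mulmx0.
Qed.

Lemma in_Rat_rsubmx d (x : 'rV[K]_(d.+1 + d.+1)) : (0 < d)%N -> in_Rat x ->
  rsubmx x != 0.
Proof.
move=> d0; rewrite /in_Rat form_resultantE; apply: contraNneq => ->.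
exact/eqP/fresultant_b0.
Qed.

Lemma coprime_ratdeg d (x : 'rV[K]_(d.+1 + d.+1)) :
  coprimep (binpoly (lsubmx x)) (binpoly (rsubmx x)) ->
  size (binpoly (rsubmx x)) = d.+1 -> ratdeg (phi_ab x) = d.
Proof.
move=> cab sb; have b0 : binpoly (rsubmx x) != 0 by rewrite -size_poly_eq0 sb.
rewrite phi_abE ratdeg_div //; move: cab; rewrite /coprimep.
set g := gcdp _ _ => /eqP sg.
have sdiv (p : {poly K}) : size (p %/ g) = size p.
  by rewrite size_divp -?size_poly_eq0 sg // subn0.
rewrite !sdiv sb; have := size_binpoly (lsubmx x).
by move/maxn_idPr->.
Qed.

(** Degree d after reduction forces the gcd to be constant and one of the two forms to have full
    degree, as [fresultant_neq0] requires. *)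
Lemma ratdeg_in_Rat d (x : 'rV[K]_(d.+1 + d.+1)) : (0 < d)%N ->
  rsubmx x != 0 -> ratdeg (phi_ab x) = d -> in_Rat x.
Proof.
move=> d0 b0; rewrite -binpoly_eq0 in b0; rewrite phi_abE ratdeg_div //.
set a := lsubmx x in b0 *; set b := rsubmx x in b0 *; set g := gcdp _ _ => E.
have g0 : g != 0 by rewrite gcdp_eq0 negb_and b0 orbT.
have {E} : maxn (size (binpoly a %/ g)) (size (binpoly b %/ g)) = d.+1.
  move: E d0; move: (maxn _ _) => l <-; by case: l.
rewrite !size_divp // => E.
have sg : size g = 1%N.
  have := size_binpoly a; have := size_binpoly b; move: g0 E.
  rewrite -size_poly_gt0; clear.
  by move: (size g) (size (binpoly a)) (size (binpoly b)) => ? ? ?; lia.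
have cab : coprimep (binpoly a) (binpoly b) by rewrite /coprimep -/g sg.
rewrite /in_Rat form_resultantE; apply: fresultant_neq0 => //.
move: E; rewrite sg -/a -/b; move: (size (binpoly a)) (size (binpoly b)) => sa sb.
by clear; lia.
Qed.

End FormResultant.

(** * Preimages and density *)

Lemma uniq_map_inj_in (T1 T2 : eqType) (f : T1 -> T2) (s : seq T1) :
  uniq (map f s) -> {in s &, injective f}.
Proof.
elim: s => //= x s IH /andP[fx us] a b; rewrite !inE.
move=> /predU1P[->|sa] /predU1P[->|sb] // E; last exact: IH E.
  by case/negP: fx; apply/mapP; exists b.
by case/negP: fx; apply/mapP; exists a.
Qed.

Lemma size_rVpoly_leq (R : nzSemiRingType) n (u : 'rV[R]_n) :
  (size (rVpoly u) <= n)%N.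
Proof. exact: size_poly. Qed.

(** * Landen numerators over a split denominator *)

Section SplitDenominator.

Variables (L : fieldType) (zeta : L) (m k : nat) (gs : seq L) (c : L).
Local Notation M := m.+1.
Hypothesis zetaP : M.-primitive_root zeta.
Hypothesis km : (k < M)%N.
Hypothesis M0 : M%:R != 0 :> L.
Hypothesis c0 : c != 0.
Hypothesis gs_uniq : uniq [seq g ^+ M | g <- gs].
Hypothesis gs0 : 0 \notin gs.

Let d := size gs.
Let B : {poly L} := c *: \prod_(g <- gs) ('X - g%:P).
Let H := cofactor_sum m B.
Let N := section m 0 (cnorm m B).

Lemma size_split : size B = d.+1.
Proof. by rewrite size_scale // size_prod_XsubC. Qed.

Lemma root_split g : root B g = (g \in gs).
Proof. by rewrite rootZ // root_prod_XsubC. Qed.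

Lemma coef_split : B`_d = c.
Proof.
have := lead_coefZ c (\prod_(g <- gs) ('X - g%:P)).
by rewrite lead_coefE size_split /= (monicP (monic_prod_XsubC _ _ _)) mulr1.
Qed.

Lemma norm_comp_split : N \Po 'X^M = B * H.
Proof. by rewrite mul_cofactor_sum section_comp //; apply: in_residue_cnorm. Qed.

(** The d distinct values g^(m+1) are roots of N, whose degree is d and whose leading coefficient
    comes from [cnorm_top]. *)
Lemma norm_split : N = ((-1) ^+ rot_sign m d * c ^+ M) *:
  \prod_(z <- [seq g ^+ M | g <- gs]) ('X - z%:P).
Proof.
have Nd : N`_d = (-1) ^+ rot_sign m d * c ^+ M.
  by rewrite coef_section addn0 cnorm_top ?size_split // coef_split.
have Nd0 : N`_d != 0 by rewrite Nd mulf_neq0 ?signr_eq0 ?expf_neq0.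
have sN : size N = d.+1.
  apply/anti_leq/andP; split; last first.
    by rewrite ltnNge; apply: contra Nd0 => ?; rewrite nth_default.
  apply/leq_sizeP => l dl; rewrite coef_section nth_default // addn0.
  apply: leq_trans (size_cnorm _ (_ : (_ <= d.+1)%N)) _;
    first by rewrite size_split.
  by rewrite ltn_pmul2l.
have := @all_roots_prod_XsubC _ N [seq g ^+ M | g <- gs].
rewrite size_map -/d uniq_rootsE lead_coefE sN /= Nd; apply=> //.
apply/allP=> _ /mapP[g gg ->]; have := congr1 (horner^~ g) norm_comp_split.
rewrite hornerM (rootP (_ : root B g)) ?root_split // mul0r.
by rewrite horner_comp hornerXn => /rootP.
Qed.

Lemma norm_root g : g \in gs -> N.[g ^+ M] = 0.
Proof.
move=> gg; rewrite norm_split hornerZ.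
have /rootP-> : root (\prod_(z <- [seq g ^+ M | g <- gs]) ('X - z%:P)) (g ^+ M).
  by rewrite root_prod_XsubC; apply/mapP; exists g.
by rewrite mulr0.
Qed.

(** Differentiating N(w^(m+1)) = B H at a root g of B leaves B'(g) H(g) on the right. On the left
    stands N'(g^(m+1)) (m+1) g^m, nonzero as N has simple roots and g is nonzero. *)
Lemma cofactor_neq0 g : g \in gs -> H.[g] != 0.
Proof.
move=> gg; have g0 : g != 0 by apply: contraNneq gs0 => <-.
have := congr1 (fun p => (p^`()).[g]) norm_comp_split.
rewrite /= derivM hornerD !hornerM (rootP (_ : root B g)) ?root_split //.
rewrite mul0r addr0 deriv_comp hornerM horner_comp derivXn hornerXn => E.
have : N^`().[g ^+ M] * ('X^m *+ M).[g] != 0.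
  rewrite hornerMn hornerXn -mulr_natr !mulf_neq0 ?expf_neq0 //.
  rewrite norm_split derivZ hornerZ !mulf_neq0 ?signr_eq0 ?expf_neq0 //.
  move: gs_uniq; rewrite -separable_prod_XsubC separable_poly.unlock => cop.
  apply: (coprimep_root cop).
  by rewrite root_prod_XsubC; apply/mapP; exists g.
by rewrite E; apply: contraNneq => ->; rewrite mulr0.
Qed.

(* In the sum over the rotations z^t g of a root g, all terms but that of t = 0
   vanish, as z^t g is a root of N(w^M) = B H but not of B. *)
Lemma section_at_root (A : {poly L}) g : g \in gs ->
  M%:R * g ^+ k * (section m k (A * H)).[g ^+ M] = A.[g] * H.[g].
Proof.
move=> gg; have g0 : g != 0 by apply: contraNneq gs0 => <-.
have := congr1 (horner^~ g) (sum_section zetaP (A * H) km).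
rewrite hornerM horner_comp !hornerM hornerXn hornerXn -polyC_natr hornerC => <-.
rewrite horner_sum (bigD1 ord0) //= muln0 !expr0 invr1 !scale1r comp_polyXr.
rewrite hornerM big1 ?addr0 // => t t0.
rewrite hornerZ horner_comp hornerZ hornerX hornerM.
suff -> : H.[zeta ^+ t * g] = 0 by rewrite !mulr0.
have := congr1 (horner^~ (zeta ^+ t * g)) norm_comp_split.
rewrite horner_comp hornerXn exprMn -exprM mulnC exprM (prim_expr_order zetaP).
rewrite expr1n mul1r norm_root // hornerM => /esym/eqP.
rewrite mulf_eq0 => /orP[|/eqP//]; rewrite -[_ == 0]/(root B _) root_split => tg.
have E : (zeta ^+ t * g) ^+ M = g ^+ M.
  by rewrite exprMn -exprM mulnC exprM (prim_expr_order zetaP) expr1n mul1r.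
have := uniq_map_inj_in gs_uniq tg gg E => /eqP;
  rewrite -subr_eq0 -[X in _ - X]mul1r.
rewrite -mulrBl mulf_eq0 (negPf g0) orbF subr_eq0 -(expr0 zeta).
rewrite (eq_prim_root_expr zetaP) !modn_small // => /eqP t_0.
by case/eqP: t0; apply: val_inj.
Qed.

Lemma section_injective (A : {poly L}) :
  (size A <= d)%N -> section m k (A * H) = 0 -> A = 0.
Proof.
move=> sA S0; apply/eqP; apply: contraTT sA => A0; rewrite -ltnNge.
apply: max_poly_roots => //; last exact: map_uniq gs_uniq.
apply/allP=> g gg; have := section_at_root A gg; rewrite S0 horner0 mulr0.
by move=> /esym/eqP; rewrite mulf_eq0 (negPf (cofactor_neq0 gg)) orbF.
Qed.

Lemma section_is_linear : linear (section m k : {poly L} -> {poly L}).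
Proof.
by move=> a p q; apply/polyP=> l; rewrite coefD coefZ !coef_section coefD coefZ.
Qed.

(** An injective endomorphism of the space of polynomials of degree less than d is bijective. *)
Lemma section_surjective (P : {poly L}) :
  (size P <= d)%N -> exists2 A : {poly L}, (size A <= d)%N & section m k (A * H)
    = P.
Proof.
move=> sP; pose F (u : 'rV[L]_d) : 'rV[L]_d := poly_rV (section m k (rVpoly u * H)).
have Flin : linear F.
  by move=> a u v; rewrite /F linearP mulrDl -scalerAl section_is_linear linearP.
pose F' : {linear 'rV[L]_d -> 'rV[L]_d} := HB.pack F (GRing.isLinear.Build _ _ _
  _ F Flin).
(* A H has size at most (m+1)d, so its section has size at most d and [poly_rV] loses nothing. *)
have sF (u : 'rV[L]_d) : (size (section m k (rVpoly u * H)) <= d)%N.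
  apply: size_section; apply: leq_trans (size_polyMleq _ _) _.
  have : (size (rVpoly u) <= d)%N by apply: size_rVpoly_leq.
  have : (size H <= (m * d).+1)%N.
    by apply: size_cofactor_sum; rewrite size_split.
  by rewrite mulSn; move: (size H) (size (rVpoly u)) (m * d)%N => a b e; clear; lia.
have Munit : lin1_mx F' \in unitmx.
  rewrite -row_free_unit; apply: inj_row_free => v; rewrite mul_rV_lin1 /= => Fv0.
  have S0 : section m k (rVpoly v * H) = 0.
    by rewrite -[LHS](poly_rV_K (sF v)) -/(F v) Fv0 linear0.
  by rewrite -[v]rVpolyK (section_injective (size_rVpoly_leq _) S0) linear0.
pose u := poly_rV P *m invmx (lin1_mx F').
exists (rVpoly u); first exact: size_rVpoly_leq.
have Fu : F u = poly_rV P by rewrite -[F u](mul_rV_lin1 F') mulmxKV.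
by rewrite -[LHS](poly_rV_K (sF u)) -/(F u) Fu poly_rV_K.
Qed.

End SplitDenominator.

Import Num.Theory.

Lemma binpoly_inj (R : comNzRingType) d : injective (@binpoly R d).
Proof. exact: can_inj (@binpolyK R d). Qed.

Lemma binpolyZ (R : comNzRingType) d (c : R) (a : 'rV[R]_d.+1) :
  binpoly (c *: a) = c *: binpoly a.
Proof.
by rewrite /binpoly scaler_sumr; apply: eq_bigr => i _; rewrite mxE scalerA.
Qed.

Lemma size_binpoly_lead (R : comNzRingType) d (a : 'rV[R]_d.+1) :
  a 0 ord0 != 0 -> size (binpoly a) = d.+1.
Proof.
move=> a0; apply/anti_leq; rewrite size_binpoly ltnNge /=.
by apply: contra a0 => sa; rewrite -coef_binpoly_d nth_default.
Qed.

Lemma fresultant_coprime d (a b : 'rV[algC]_d.+1) : (0 < d)%N ->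
  fresultant a b != 0 -> coprimep (binpoly a) (binpoly b).
Proof.
move=> d0 ab; apply: Pdiv.ClosedField.root_coprimep => g ag; apply: contra ab => bg.
by apply/eqP/(fresultant_root d0 ag).
Qed.

Section LandenVectors.

Variables (K : fieldType) (m k d : nat).
Implicit Types x : 'rV[K]_(d.+1 + d.+1).

Lemma rsubmx_landen_vec x : rsubmx x != 0 -> rsubmx (landen_vec m k x) != 0.
Proof.
by move=> b0; rewrite -binpoly_eq0 binpoly_landen_den landen_den_neq0.
Qed.

Lemma landen_vec_neq0 x : rsubmx x != 0 -> landen_vec m k x != 0.
Proof. by move=> /rsubmx_landen_vec; apply: contraNneq => ->; rewrite linear0. Qed.

Lemma landen_map_maps_to x : rsubmx x != 0 ->
  maps_to (landen_map m k d) x (landen_vec m k x).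
Proof.
move=> b0; exists (landen_map m k d); first exact: ratmap_eq_refl.
rewrite landen_map_at landen_vec_neq0 //; split=> //.
by exists 1; rewrite ?oner_neq0 ?scale1r.
Qed.

End LandenVectors.

(** By uniqueness [psi] is the function given by [landen_vec]; as its degree is d, the vector lies
    in Rat_d. *)
Lemma landen_map_property m k d : (k < m.+1)%N -> (0 < d)%N ->
  landen_property m.+1 k (landen_map m k d).
Proof.
move=> km d0 K m0 L iota zeta zP x psi Rx lx dpsi.
have b0 := in_Rat_rsubmx d0 Rx.
have psiE := is_landen_unique (landen_vec_is_landen iota m0 zP km b0) lx.
exists (landen_vec m k x); split=> //; first exact: landen_map_maps_to.
by apply: ratdeg_in_Rat => //; rewrite ?rsubmx_landen_vec // psiE.
Qed.

Lemma algC_prim_root m : {z : algC | m.+1.-primitive_root z}.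
Proof. exact: C_prim_root_exists. Qed.

Lemma natrC_neq0 m : m.+1%:R != 0 :> algC.
Proof. by rewrite pnatr_eq0. Qed.

(** Full degree, no root at 0 and simple roots: the conditions for the split case to apply after
    extracting roots. *)
Definition good_denominator d (b : 'rV[algC]_d.+1) :=
  [/\ b 0 ord0 != 0, b 0 ord_max != 0 & separable_poly (binpoly b)].

(** B is built from (m+1)-th roots of the roots of N, then A is found by linear algebra. The clause
    on a_0 serves the restriction to the hyperplane; those on size and coprimality serve
    uniqueness. *)
Lemma landen_preimage m k d (y : 'rV[algC]_(d.+1 + d.+1)) : (k < m.+1)%N ->
  good_denominator (rsubmx y) -> k = 0%N \/ lsubmx y 0 ord0 = 0 ->
  exists x, [/\ landen_vec m k x = y,
    lsubmx y 0 ord0 = 0 -> lsubmx x 0 ord0 = 0,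
    size (binpoly (rsubmx x)) = d.+1 &
    coprimep (binpoly (lsubmx y)) (binpoly (rsubmx y)) ->
    coprimep (binpoly (lsubmx x)) (binpoly (rsubmx x))].
Proof.
move=> km [b0 bd sepb] hk; have [zeta zP] := algC_prim_root m.
set P : {poly algC} := binpoly (lsubmx y);
  set N : {poly algC} := binpoly (rsubmx y) in sepb *.
have [r NE] := closed_field_poly_normal N.
have sN : size N = d.+1 by apply: size_binpoly_lead.
have Nl : lead_coef N = rsubmx y 0 ord0 by rewrite lead_coefE sN coef_binpoly_d.
have Nl0 : lead_coef N != 0 by rewrite Nl.
pose gs : seq algC := [seq m.+1.-root z | z <- r].
have gsE : [seq g ^+ m.+1 | g <- gs] = r.
  by rewrite -map_comp -[RHS]map_id; apply: eq_map => z /=; rewrite rootCK.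
(* This constant makes the leading coefficient of the norm of B, which is c^(m+1) up to the sign
   [rot_sign], equal to that of N. *)
pose c : algC := m.+1.-root ((-1) ^+ rot_sign m d * lead_coef N).
have cE : c ^+ m.+1 = (-1) ^+ rot_sign m d * lead_coef N by rewrite rootCK.
have c0 : c != 0.
  have : c ^+ m.+1 != 0 by rewrite cE mulf_neq0 ?signr_eq0.
  by rewrite expf_eq0.
have r_uniq : uniq [seq g ^+ m.+1 | g <- gs].
  rewrite gsE -separable_prod_XsubC; move: sepb; rewrite NE.
  by rewrite (eqp_separable (eqp_scale _ Nl0)).
have gs0 : 0 \notin gs.
  apply: contra bd => gs0; rewrite -coef_binpoly_0 -/N -horner_coef0.
  rewrite NE hornerZ mulf_eq0; apply/orP; right.
  rewrite -[_ == 0]/(root _ 0) root_prod_XsubC -gsE; apply/mapP; exists 0 => //.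
  by rewrite expr0n.
have sgs : size gs = d.
  move: sN; rewrite NE size_scale // size_prod_XsubC => -[<-].
  by rewrite size_map.
set B : {poly algC} := c *: \prod_(g <- gs) ('X - g%:P); set H := cofactor_sum m B.
have sB : size B = d.+1 by rewrite size_split // sgs.
have NB : section m 0 (cnorm m B) = N.
  by rewrite norm_split // sgs cE mulrA -signr_addb addbb mul1r gsE -NE.
have [A [sA sA0 AH]] : exists A : {poly algC}, [/\ (size A <= d.+1)%N,
    lsubmx y 0 ord0 = 0 -> (size A <= d)%N & section m k (A * H) = P].
  have [a0|a0] := eqVneq (lsubmx y 0 ord0) 0.
    have := section_surjective zP km (natrC_neq0 m) c0 r_uniq gs0 (P := P).
    rewrite sgs => -[|A sA AH]; first exact: size_binpoly_lead0.
    by exists A; split=> //; apply: leq_trans sA _.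
  have k0 : k = 0%N by case: hk => // a0'; rewrite a0' eqxx in a0.
  (* Subtracting e N from P kills the coefficient of z^d. As the section of B H is N for k = 0,
     adding e B to A compensates for it. *)
  pose e : algC := lsubmx y 0 ord0 / lead_coef N.
  have sP1 : (size (P - e *: N)%R <= d)%N.
    rewrite -[P - _](@coefrowK _ d); last first.
      rewrite (leq_trans (size_polyD _ _)) // geq_max size_binpoly size_polyN.
      by rewrite (leq_trans (size_scale_leq _ _)) // size_binpoly.
    apply: size_binpoly_lead0; rewrite mxE subn0 coefB coefZ !coef_binpoly_d.
    by rewrite /e -Nl divfK ?subrr.
  have := section_surjective zP km (natrC_neq0 m) c0 r_uniq gs0 (P := P - e *: N).
  rewrite sgs => -[//|A sA AH].
  exists (A + e *: B); split.
  - rewrite (leq_trans (size_polyD _ _)) // geq_max (leq_trans sA) //=.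
    by rewrite (leq_trans (size_scale_leq _ _)) // sB.
  - by move=> a0'; rewrite a0' eqxx in a0.
  rewrite mulrDl -scalerAl mul_cofactor_sum addrC section_is_linear AH k0 NB.
  by rewrite addrC subrK.
pose x : 'rV[algC]_(d.+1 + d.+1) := row_mx (coefrow d A) (coefrow d B).
have xA : binpoly (lsubmx x) = A by rewrite row_mxKl coefrowK.
have xB : binpoly (rsubmx x) = B by rewrite row_mxKr coefrowK ?sB.
exists x; split.
- rewrite /landen_vec /landen_num /landen_den /landen_aux xA xB AH NB.
  by rewrite !binpolyK hsubmxK.
- by move=> /sA0 sA'; rewrite row_mxKl mxE subn0 nth_default.
- by rewrite xB.
(* A common root g of A and B would make P vanish at g^(m+1), which is a root of N. *)
move=> copPN; rewrite xA xB; apply: Pdiv.ClosedField.root_coprimep => g /rootP Ag.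
apply/negP; rewrite -[_ == 0]/(root B g) root_split // => gg.
have g0 : g != 0 by apply: contraNneq gs0 => <-.
have := section_at_root zP km c0 r_uniq gs0 A gg;
  rewrite Ag mul0r -/B -/H AH => /eqP.
rewrite mulf_eq0 (negPf (mulf_neq0 (natrC_neq0 m) (expf_neq0 k g0))) /= => Pg.
have := coprimep_root copPN Pg.
by rewrite -/N -NB norm_root // eqxx.
Qed.

(** * Density of the good denominators, in the whole space and in the hyperplane *)

Section Density.

Variable d : nat.
Hypothesis d0 : (0 < d)%N.
Local Notation n := (d.+1 + d.+1)%N.

(** An integral polynomial in b whose nonvanishing gives [good_denominator]. The derivative is
    treated as a form of degree d, with top coefficient 0. *)
Definition discriminant (R : comNzRingType) (b : 'rV[R]_d.+1) : R :=
  b 0 ord0 * b 0 ord_max * fresultant b (coefrow d (binpoly b)^`()).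

Lemma map_discriminant (R S : comNzRingType)
    (f : {rmorphism R -> S}) (b : 'rV[R]_d.+1) :
  f (discriminant b) = discriminant (map_mx f b).
Proof.
rewrite /discriminant !rmorphM map_fresultant map_coefrow -deriv_map map_binpoly.
by rewrite !mxE.
Qed.

Lemma size_deriv_binpoly (R : comNzRingType) (b : 'rV[R]_d.+1) :
  (size (binpoly b)^`() <= d.+1)%N.
Proof. by apply: leq_trans (leq_trans (size_poly _ _) (leq_pred _)) (size_binpoly
  b). Qed.

Lemma discriminant_good (b : 'rV[algC]_d.+1) : discriminant b != 0 ->
  good_denominator b.
Proof.
rewrite !mulf_eq0 !negb_or => /andP[/andP[b0 bd] res]; split=> //.
rewrite separable_poly.unlock.
by have := fresultant_coprime d0 res; rewrite coefrowK // size_deriv_binpoly.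
Qed.

(** The function 1/(z^d - 1), at which the discriminant is nonzero. As its a_0 vanishes, it serves
    both for the whole space and for the hyperplane. *)
Definition good_point : 'rV[algC]_n :=
  row_mx (coefrow d 1) (coefrow d ('X^d - 1)).

Lemma good_point_num : binpoly (lsubmx good_point) = 1.
Proof. by rewrite row_mxKl coefrowK // size_poly1. Qed.

Lemma good_point_den : binpoly (rsubmx good_point) = 'X^d - 1.
Proof. by rewrite row_mxKr coefrowK // size_XnsubC. Qed.

Lemma good_point_a0 : lsubmx good_point 0 ord0 = 0.
Proof. by rewrite row_mxKl mxE subn0 coef1; case: d d0. Qed.

Lemma discriminant_good_point : discriminant (rsubmx good_point) != 0.
Proof.
rewrite /discriminant -coef_binpoly_d -coef_binpoly_0 good_point_den.
rewrite !coefB !coefXn !coef1 !eqxx gtn_eqF // ltn_eqF // subr0 sub0r mul1r.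
rewrite mulf_neq0 ?oppr_eq0 ?oner_eq0 //.
have sE : size ('X^d - 1 : {poly algC}) = d.+1 by rewrite size_XnsubC.
apply: fresultant_neq0; rewrite good_point_den ?sE; last by left.
rewrite coefrowK; last by rewrite (leq_trans (size_poly _ _)) // sE.
apply: Pdiv.ClosedField.root_coprimep => z;
  rewrite rootE !hornerE subr_eq0 => /eqP z1.
rewrite derivB derivXn derivC subr0 hornerMn hornerXn -mulr_natr.
rewrite mulf_neq0 ?pnatr_eq0 -?lt0n //; apply/expf_neq0/negP=> /eqP z0.
by move/eqP: z1; rewrite z0 expr0n gtn_eqF // eq_sym oner_eq0.
Qed.

(** The product p q vanishes at all points over [algC], hence is zero, and q is not. *)
Lemma mpoly_dense_eq0 r (p q : {mpoly int[r]}) (v : 'rV[algC]_r) :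
  mpoly_at q v != 0 ->
  (forall u : 'rV[algC]_r, mpoly_at q u != 0 -> mpoly_at p u = 0) -> p = 0.
Proof.
move=> qv qp; have: p * q = 0.
  apply: mpoly_eq0_alg => u; rewrite mpoly_atE rmorphM /= -/(mpoly_at p u)
    -/(mpoly_at q u).
  by case: (eqVneq (mpoly_at q u) 0) => [->|/qp->]; rewrite ?mulr0 ?mul0r.
move=> /eqP; rewrite mulf_eq0 => /orP[/eqP//|/eqP q0].
by rewrite q0 mpoly_atE rmorph0 eqxx in qv.
Qed.

Lemma dense_good (p : {mpoly int[n]}) :
  (forall y : 'rV[algC]_n, good_denominator (rsubmx y) -> mpoly_at p y = 0) ->
    p = 0.
Proof.
move=> pgood; pose q := discriminant (rsubmx (gen_row n)).
have qE y : mpoly_at q y = discriminant (rsubmx y).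
  by rewrite mpoly_atE map_discriminant map_rsubmx map_gen_row.
apply: (@mpoly_dense_eq0 _ p q good_point); rewrite ?qE ?discriminant_good_point //.
by move=> y; rewrite qE => /discriminant_good; apply: pgood.
Qed.

(** Version of [a0_incl] over a commutative ring; [d.+1 + d.+1] is convertible to
    [1 + (d + d.+1)]. *)
Definition a0_row (R : comNzRingType) (u : 'rV[R]_(d + d.+1)) : 'rV[R]_n :=
  row_mx (0 : 'rV[R]_1) u.

Lemma map_a0_row (R S : comNzRingType)
    (f : {rmorphism R -> S}) (u : 'rV[R]_(d + d.+1)) :
  map_mx f (a0_row u) = a0_row (map_mx f u).
Proof. by rewrite /a0_row (map_row_mx f (0 : 'rV_1)) map_mx0. Qed.

Lemma a0_row_lsubmx (R : comNzRingType) (u : 'rV[R]_(d + d.+1)) :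
  lsubmx (a0_row u) 0 ord0 = 0.
Proof.
rewrite mxE; have -> : lshift d.+1 (ord0 : 'I_d.+1) = lshift (d + d.+1) (ord0 :
  'I_1).
  exact: val_inj.
by apply: (etrans (@row_mxEl R 1 1 (d + d.+1) 0 u 0 ord0)); rewrite mxE.
Qed.

Lemma a0_row_rshift (R : comNzRingType) (u : 'rV[R]_(d + d.+1)) (i : 'I_d.+1) :
  a0_row u 0 (rshift d.+1 i) = u 0 (rshift d i).
Proof.
have -> : rshift d.+1 i = rshift 1 (rshift d i) by apply: val_inj.
exact: (@row_mxEr R 1 1 (d + d.+1)).
Qed.

Lemma a0_rowP (R : comNzRingType) (y : 'rV[R]_n) : lsubmx y 0 ord0 = 0 ->
  y = a0_row (rsubmx (y : 'rV_(1 + (d + d.+1)))).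
Proof.
move=> y0; rewrite -[LHS](@hsubmxK _ 1 1 (d + d.+1));
  congr (@row_mx R 1 1 (d + d.+1) _ _).
apply/rowP=> i; rewrite [RHS]mxE -[RHS]y0 !mxE; congr (y 0 _).
by apply: val_inj; rewrite /= [i]ord1.
Qed.

Lemma dense_good_a0 (p : {mpoly int[d + d.+1]}) :
  (forall u : 'rV[algC]_(d + d.+1), good_denominator (rsubmx (a0_row u)) ->
     mpoly_at p u = 0) -> p = 0.
Proof.
move=> pgood; pose q := discriminant (rsubmx (a0_row (gen_row (d + d.+1)))).
have qE u : mpoly_at q u = discriminant (rsubmx (a0_row u)).
  by rewrite mpoly_atE map_discriminant map_rsubmx map_a0_row map_gen_row.
apply: (@mpoly_dense_eq0 _ p q (rsubmx (good_point : 'rV_(1 + (d + d.+1))))).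
  by rewrite qE -(a0_rowP good_point_a0) discriminant_good_point.
by move=> y; rewrite qE => /discriminant_good; apply: pgood.
Qed.

End Density.

(** * The rational map and its restriction to the hyperplane *)

(** The points where x and its image have nonzero resultants and b_0 is nonzero are dense. There R
    must take the value [landen_vec], so all cross products vanish. *)
Lemma landen_map_unique m k d (R : ratmap (d.+1 + d.+1) (d.+1 + d.+1)) :
  (k < m.+1)%N -> (0 < d)%N -> landen_property m.+1 k R ->
  ratmap_eq (landen_map m k d) R.
Proof.
move=> km d0 LR i j; apply/eqP; rewrite -subr_eq0; apply/eqP.
set p := _ - _; pose X := gen_row (d.+1 + d.+1); pose Y := landen_vec m k X.
pose q := fresultant (lsubmx X) (rsubmx X) *
  (fresultant (lsubmx Y) (rsubmx Y) * rsubmx X 0 ord0).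
have qE (x : 'rV[algC]_(d.+1 + d.+1)) : mpoly_at q x =
    fresultant (lsubmx x) (rsubmx x) *
    (fresultant (lsubmx (landen_vec m k x)) (rsubmx (landen_vec m k x)) *
     rsubmx x 0 ord0).
  rewrite mpoly_atE /q rmorphM; congr (_ * _).
    by rewrite map_fresultant map_lsubmx map_rsubmx map_gen_row.
  rewrite rmorphM; congr (_ * _).
    by rewrite map_fresultant map_lsubmx map_rsubmx map_landen_vec map_gen_row.
  by rewrite 3!mxE mp_evalX.
(* A preimage of [good_point] shows that q is not identically zero. *)
have [x0 [x0E _ sx0 copx0]] := landen_preimage (y := good_point d) km
  (discriminant_good d0 (discriminant_good_point d0)) (or_intror (good_point_a0
    d0)).
have good_cop : coprimep (binpoly (lsubmx (good_point d))) (binpoly (rsubmx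
  (good_point d))).
  by rewrite good_point_num coprime1p.
apply: (@mpoly_dense_eq0 _ p q x0).
  rewrite qE x0E !mulf_neq0 //.
  - by apply: fresultant_neq0; [apply: copx0 | right].
  - apply: fresultant_neq0 => //; right; rewrite good_point_den //.
    exact: size_XnsubC.
  - by apply/eqP=> /size_binpoly_lead0; rewrite sx0 ltnn.
move=> x; rewrite qE !mulf_eq0 !negb_or => /and3P[Rx Ry b0].
have bx : rsubmx x != 0 by apply: contraNneq b0 => ->; rewrite mxE.
have [zeta zP] := algC_prim_root m.
have lx := landen_vec_is_landen idfun (natrC_neq0 m) zP km bx.
pose y := landen_vec m k x.
have cop : coprimep (binpoly (lsubmx y)) (binpoly (rsubmx y)) by apply:
  fresultant_coprime.
(* Since b_0 is nonzero the new denominator has full degree, so the transform has degree d and the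
   property of R applies to x. *)
have sN : size (binpoly (rsubmx y)) = d.+1.
  apply: size_binpoly_lead; rewrite mxE landen_vec_b0 mulf_neq0 ?signr_eq0 //.
  by apply: expf_neq0; move: b0; rewrite mxE.
have dy : ratdeg (phi_ab y) = d by apply: coprime_ratdeg.
have [z [[g Rg [gx [c c0 zE]]] Rz phiz]] := LR _ (natrC_neq0 m) _ _ _ zP x _ Rx
  lx dy.
have bz := in_Rat_rsubmx d0 Rz.
have by0 : rsubmx y != 0 by apply: rsubmx_landen_vec.
have /eqP := phiz; rewrite !phi_abE tofrac_div_eq ?binpoly_eq0 // => /eqP E.
(* Both y and z represent the transform, and the fraction of y is reduced with a denominator of
   degree d, so z is a scalar multiple of y. *)
have [e zyE] : exists e, z = e *: y.
  have /dvdpP[e bE] : binpoly (rsubmx y) %| binpoly (rsubmx z).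
    rewrite coprimep_sym in cop.
    by rewrite -(Gauss_dvdpr _ cop) -E dvdp_mull.
  have se : (size e <= 1)%N.
    have e0 : e != 0.
      by apply: contraNneq bz => e0; rewrite -binpoly_eq0 bE e0 mul0r.
    have := size_binpoly (rsubmx z); rewrite bE size_mul ?binpoly_eq0 // sN.
    by rewrite addnS /= -[d.+1]add1n leq_add2r.
  have eC := size1_polyC se; exists e`_0; rewrite -[z]hsubmxK -[y]hsubmxK
    scale_row_mx.
  have bE' : rsubmx z = e`_0 *: rsubmx y.
    by apply: binpoly_inj; rewrite binpolyZ bE {1}eC mul_polyC.
  congr row_mx => //; apply: binpoly_inj; rewrite binpolyZ.
  have N0 : binpoly (rsubmx y) != 0 by rewrite binpoly_eq0.
  by apply: (mulIf N0); rewrite E bE' binpolyZ -scalerAl -scalerAr.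
have e0 : e != 0 by apply: contraNneq bz => e0; rewrite zyE e0 scale0r linear0.
have yE : y = (e^-1 * c) *: ratmap_at g x.
  by rewrite -scalerA -zE zyE scalerA mulVf ?scale1r.
have Rgx a b : mpoly_at (R a) x * mpoly_at (g b) x = mpoly_at (R b) x * mpoly_at
  (g a) x.
  by rewrite !mpoly_atE -!rmorphM Rg.
have fE a : mpoly_at (landen_map m k d a) x = (e^-1 * c) * mpoly_at (g a) x.
  transitivity (y 0 a); first by rewrite /y -landen_map_at mxE.
  by rewrite yE 2!mxE.
rewrite /p mpoly_atE rmorphB !rmorphM /= -!/(mpoly_at _ x) !fE.
by rewrite -!mulrA [mpoly_at (g i) x * _]mulrC Rgx [mpoly_at (g j) x * _]mulrC
  subrr.
Qed.

Section HyperplaneMap.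

Variables (m k d : nat).
Local Notation r := (d + d.+1)%N.

(** Coordinates of the image of the generic point of the hyperplane; the dropped first one is 0. *)
Definition landen_a0_coord (i : 'I_r) : {mpoly int[r]} :=
  landen_vec m k (a0_row (gen_row r)) 0 (rshift 1 i).

Lemma a0_row_homog i : a0_row (gen_row r) 0 i \is 1.-homog.
Proof.
rewrite -[i]/(i : 'I_(1 + r)); case: (@split_ordP 1 r i) => j ->.
  have -> : a0_row (gen_row r) 0 (lshift r j) = 0.
    by apply: (etrans (@row_mxEl _ 1 1 r 0 _ 0 j)); rewrite mxE.
  exact: dhomog0.
have -> : a0_row (gen_row r) 0 (rshift 1 j) = gen_row r 0 j.
  exact: (@row_mxEr _ 1 1 r).
exact: gen_row_homog.
Qed.

Lemma landen_a0_coord_homog i : landen_a0_coord i \is m.+1.-homog.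
Proof. exact/homog_landen_vec/a0_row_homog. Qed.

Lemma landen_a0_coord_b0 : landen_a0_coord (rshift d ord0) =
  (-1) ^+ rot_sign m d * 'X_[U_(rshift d ord0) *+ m.+1].
Proof.
rewrite /landen_a0_coord.
have -> : rshift 1 (rshift d ord0) = rshift d.+1 (ord0 : 'I_d.+1) by apply: val_inj.
by rewrite landen_vec_b0 a0_row_rshift mxE mpolyXn.
Qed.

Lemma landen_a0_coord_bd : landen_a0_coord (rshift d ord_max) =
  'X_[U_(rshift d ord_max) *+ m.+1].
Proof.
rewrite /landen_a0_coord.
have -> : rshift 1 (rshift d ord_max) = rshift d.+1 (ord_max :
  'I_d.+1) by apply: val_inj.
by rewrite landen_vec_bd a0_row_rshift mxE mpolyXn.
Qed.

Lemma landen_a0_coord_neq0 : exists i, landen_a0_coord i != 0.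
Proof. by exists (rshift d ord_max); rewrite landen_a0_coord_bd mpolyX_neq0. Qed.

Definition landen_map_a0 : ratmap r r :=
  RatMap landen_a0_coord_homog landen_a0_coord_neq0.

Lemma landen_map_a0_reduced : (0 < d)%N -> reduced landen_map_a0.
Proof.
move=> d0; apply: (@reduced_monomials _ _ landen_map_a0 _ _ _ _ _ _
  landen_a0_coord_b0 landen_a0_coord_bd) => l.
rewrite !mulmnE !mnm1E; case: eqP => [<-|]; last by left.
by right; case: eqP => // /rshift_inj/(congr1 val) /= E; rewrite E in d0.
Qed.

Lemma landen_vec_a0_row (K : fieldType) (u : 'rV[K]_r) :
  landen_vec m k (a0_row u) = a0_row (ratmap_at landen_map_a0 u).
Proof.
rewrite [LHS]a0_rowP; last by apply: landen_vec_a0; right; apply: a0_row_lsubmx.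
congr a0_row; rewrite -{1}[u]map_gen_row -map_a0_row -map_landen_vec.
by apply/rowP=> i; rewrite [LHS]mxE [LHS]mxE [RHS]mxE.
Qed.

End HyperplaneMap.

Lemma a0_row_inj (R : comNzRingType) d : injective (@a0_row d R).
Proof. by move=> u v /(congr1 (@rsubmx _ 1 1 (d + d.+1))); rewrite !row_mxKr. Qed.

Lemma a0_row0 (R : comNzRingType) d : a0_row (0 : 'rV[R]_(d + d.+1)) = 0.
Proof. exact: (@row_mx0 _ 1 1 (d + d.+1)). Qed.

Lemma a0_row_eq0 (R : comNzRingType) d (u : 'rV[R]_(d + d.+1)) :
  (a0_row u == 0) = (u == 0).
Proof. by rewrite -(inj_eq (@a0_row_inj R d)) a0_row0. Qed.

Lemma a0_rowZ (K : fieldType) d (c : K) (u : 'rV[K]_(d + d.+1)) :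
  a0_row (c *: u) = c *: a0_row u.
Proof. by rewrite /a0_row (@scale_row_mx _ 1 1 (d + d.+1)) scaler0. Qed.

Lemma good_preimage_neq0 m k d (x : 'rV[algC]_(d.+1 + d.+1)) :
  good_denominator (rsubmx (landen_vec m k x)) -> rsubmx x != 0.
Proof.
case=> _ bd _; apply: contraNneq bd => b0.
have E : x 0 (rshift _ ord_max) = 0 by have := congr1 (fun v :
  'rV__ => v 0 ord_max) b0; rewrite !mxE.
by rewrite mxE landen_vec_bd E expr0n.
Qed.

(** An integral form vanishing on the image vanishes at all points over [algC] with a good
    denominator, hence is 0, and so vanishes over every field. *)
Lemma landen_map_dominant m d (R : ratmap (d.+1 + d.+1) (d.+1 + d.+1)) :
  (0 < d)%N -> ratmap_eq (landen_map m 0 d) R -> dominant R.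
Proof.
move=> d0 fR K y y0; split=> // e h _ hR.
suff -> : h = 0 by rewrite mpoly_atE rmorph0.
apply: dense_good => // y' good; have km : (0 < m.+1)%N by [].
have [x [xE _ _ _]] := landen_preimage km good (or_introl erefl).
have bx : rsubmx x != 0 by apply: (@good_preimage_neq0 m 0); rewrite xE.
apply: hR; exists x; first by apply: contraNneq bx => ->; rewrite linear0.
by apply: maps_to_eq fR _; rewrite -xE; apply: landen_map_maps_to.
Qed.

Lemma landen_map_a0_dominant m k d : (k < m.+1)%N -> (0 < d)%N ->
  dominant (landen_map_a0 m k d).
Proof.
move=> km d0 K u u0; split=> // e h _ hS.
suff -> : h = 0 by rewrite mpoly_atE rmorph0.
apply: dense_good_a0 => // u' good.
have [x [xE xa0 _ _]] := landen_preimage km good (or_intror (a0_row_lsubmx u')).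
have bx : rsubmx x != 0 by apply: (@good_preimage_neq0 m k); rewrite xE.
(* The preimage lies in the hyperplane because [landen_preimage] preserves a_0 = 0. *)
have xw := a0_rowP (xa0 (a0_row_lsubmx u')); move: xw; set w := rsubmx _ => xw.
move: xE; rewrite xw landen_vec_a0_row => /a0_row_inj Sw.
have w0 : w != 0.
  by apply: contraNneq bx => w0; rewrite xw w0 a0_row0 linear0.
have Sw0 : ratmap_at (landen_map_a0 m k d) w != 0.
  by rewrite -a0_row_eq0 -landen_vec_a0_row -xw landen_vec_neq0.
apply: hS; exists w => //; exists (landen_map_a0 m k d);
  first exact: ratmap_eq_refl.
by split=> //; rewrite Sw; exists 1; rewrite ?oner_neq0 ?scale1r.
Qed.

Lemma landen_map_image m k d (R : ratmap (d.+1 + d.+1) (d.+1 + d.+1)) :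
  (0 < k < m.+1)%N -> (0 < d)%N -> ratmap_eq (landen_map m k d) R ->
  forall (K : fieldType) (y : 'rV[K]_(d.+1 + d.+1)), ratmap_image R y <-> a0_zero y.
Proof.
move=> /andP[k0 km] d0 fR K y; split=> [[y0 hy]|[y0 ya0]]; split=> //.
  (* The form of degree 1 tested on the closure is the variable a_0, which is zero on the image as k
     > 0. *)
  rewrite mxE -(mp_evalX y) -mpoly_atE; apply: (hy 1%N).
    by rewrite dhomogX /= mdeg1.
  move=> F y' [x _ /(maps_to_eq (ratmap_eq_sym fR))].
  move=> /(reduced_maps_to _ _ (landen_map_reduced d0))[_ [c _ ->]].
  rewrite mpoly_atE mp_evalX landen_map_at mxE.
  have /(_ (or_introl k0)) := @landen_vec_a0 _ m k d x.
  by rewrite mxE => ->; rewrite mulr0.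
move=> e h _ hR; rewrite (a0_rowP ya0); set u := rsubmx _.
(* The restriction of h to the hyperplane, which vanishes on the dense set of good denominators. *)
pose h' := mp_eval (a0_row (gen_row (d + d.+1))) h.
have h'E (F : fieldType) (v : 'rV[F]_(d + d.+1)) :
  mpoly_at h' v = mpoly_at h (a0_row v).
  by rewrite mpoly_atE rmorph_mp_eval map_a0_row map_gen_row.
rewrite -h'E; suff -> : h' = 0 by rewrite mpoly_atE rmorph0.
apply: dense_good_a0 => // u' good; rewrite h'E.
have [x [xE _ _ _]] := landen_preimage km good (or_intror (a0_row_lsubmx u')).
have bx : rsubmx x != 0 by apply: (@good_preimage_neq0 m k); rewrite xE.
apply: hR; exists x; first by apply: contraNneq bx => ->; rewrite linear0.
by apply: maps_to_eq fR _; rewrite -xE; apply: landen_map_maps_to.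
Qed.

Lemma landen_map_induces m k d (R : ratmap (d.+1 + d.+1) (d.+1 + d.+1)) :
  (0 < d)%N -> ratmap_eq (landen_map m k d) R ->
  induces_on_a0 R (landen_map_a0 m k d).
Proof.
move=> d0 fR; split.
  pose u : 'rV[rat]_(d + d.+1) := const_mx 1.
  have bu : rsubmx (a0_incl u) != 0.
    apply/negP=> /eqP/rowP/(_ ord0); rewrite [LHS]mxE (a0_row_rshift u) !mxE.
    by move/eqP; rewrite oner_eq0.
  exists rat, u; split.
    apply: contraNneq bu => ->; rewrite -[a0_incl 0]/(a0_row 0) a0_row0.
    by rewrite linear0.
  apply: defined_at_eq fR _; apply/(reduced_defined_at _ (landen_map_reduced d0)).
  by rewrite landen_map_at landen_vec_neq0.
move=> K u y _ /(maps_to_eq (ratmap_eq_sym fR)).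
move=> /(reduced_maps_to _ _ (landen_map_reduced d0))[fu [c c0 ->]].
move: fu; rewrite landen_map_at landen_vec_a0_row a0_row_eq0 => Su.
exists (c *: ratmap_at (landen_map_a0 m k d) u); last by rewrite -a0_rowZ.
exists (landen_map_a0 m k d); first exact: ratmap_eq_refl.
by split=> //; exists c.
Qed.

Lemma b_zero_linear d : linear_subspace_iso d.+1 (@b_zero d).
Proof.
exists (row_mx 1%:M 0), (col_mx 1%:M 0); split.
  by rewrite mul_row_col mul1mx mul0mx addr0.
move=> K x x0; rewrite map_row_mx map_mx1 map_mx0; split=> [[_ b0]|[u xE]].
  by exists (lsubmx x); rewrite mul_mx_row mulmx1 mulmx0 -b0 hsubmxK.
by split=> //; rewrite xE mul_mx_row mulmx0 row_mxKr.
Qed.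

Lemma a0_zero_linear d : linear_subspace_iso (d + d.+1) (@a0_zero d).
Proof.
exists (row_mx (0 : 'M_(_, 1)) 1%:M), (col_mx (0 : 'M_(1, _)) 1%:M); split.
  by rewrite (@mul_row_col _ _ 1) mul0mx add0r mul1mx.
have E (K : fieldType) (u : 'rV[K]_(d + d.+1)) :
    u *m map_mx intr (row_mx (0 : 'M[int]_(_, 1)) 1%:M) = a0_row u.
  by rewrite (@map_row_mx _ _ _ _ 1) map_mx1 map_mx0 (@mul_mx_row _ _ _ 1) mulmx1
    mulmx0.
move=> K x x0; split=> [[_ a0]|[u xE]].
  by rewrite (a0_rowP a0); eexists; rewrite E.
by split=> //; rewrite xE E a0_row_lsubmx.
Qed.

Theorem theorem2 (m k d : nat) (hm : (1 <= m)%N) (hk : (k < m)%N)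
    (hd : (1 <= d)%N) :
  (* (a) *)
  (exists R : ratmap (d.+1 + d.+1) (d.+1 + d.+1),
     landen_property m k R /\
     forall R' : ratmap (d.+1 + d.+1) (d.+1 + d.+1),
       landen_property m k R' -> ratmap_eq R R') /\
  forall R : ratmap (d.+1 + d.+1) (d.+1 + d.+1), landen_property m k R ->
  [/\ (* (b) *)
      [/\ (1 < m)%N ->
            forall (K : fieldType) (x : 'rV[K]_(d.+1 + d.+1)),
              indeterminacy R x <-> b_zero x,
          linear_subspace_iso d.+1 (@b_zero d) &
          forall (K : fieldType) (x : 'rV[K]_(d.+1 + d.+1)),
            x != 0 -> ~ b_zero x ->
            defined_at R x /\
            forall y : 'rV[K]_(d.+1 + d.+1), maps_to R x y -> ~ b_zero y],
      (* (c) *)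
      k = 0%N -> dominant R /\ algebraic_degree R m,
      (* (d), image *)
      (1 <= k)%N ->
        (forall (K : fieldType) (y : 'rV[K]_(d.+1 + d.+1)),
           ratmap_image R y <-> a0_zero y) &
      (* (d), hyperplane and restriction to it *)
      linear_subspace_iso (d + d.+1) (@a0_zero d) /\
      exists S : ratmap (d + d.+1) (d + d.+1),
        [/\ induces_on_a0 R S, dominant S & algebraic_degree S m]].
Proof.
case: m hm hk => // m _ km; split.
  exists (landen_map m k d); split; first exact: landen_map_property.
  by move=> R' /landen_map_unique; apply.
(* Uniqueness identifies R with the explicit map, on whose coordinates everything else is
   checked. *)
move=> R /landen_map_unique - /(_ km hd) fR.
have redf := @landen_map_reduced m k d hd.
have Rf := ratmap_eq_sym fR.
have defR (K : fieldType) (x : 'rV[K]_(d.+1 + d.+1)) :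
    rsubmx x != 0 -> defined_at R x.
  move=> b0; apply: defined_at_eq fR _; apply/(reduced_defined_at _ redf).
  by rewrite landen_map_at landen_vec_neq0.
split.
- split; [move=> m1 K x | exact: b_zero_linear | move=> K x x0 nbx].
    split=> [[x0 ndef]|[x0 b0]]; split=> //.
      by apply/eqP; apply: contraT => /defR.
    (* For b = 0 and an exponent greater than 1 the reduced tuple vanishes, and with it every
       representative. *)
    move=> /(defined_at_eq Rf)/(reduced_defined_at _ redf).
    by rewrite landen_map_at landen_vec_b_zero ?eqxx.
  have bx : rsubmx x != 0 by apply/negP=> /eqP b0; apply: nbx.
  split=> [|y /(maps_to_eq Rf)/(reduced_maps_to _ _ redf)]; first exact: defR.
  rewrite landen_map_at => -[_ [c c0 ->]] [_ /eqP].
  by rewrite linearZ scaler_eq0 (negPf c0) (negPf (rsubmx_landen_vec m k bx)).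
- move=> k0; rewrite k0 in fR Rf redf; split; first exact: landen_map_dominant fR.
  exact: reduced_algebraic_degree Rf.
- by move=> k1 K y; apply: landen_map_image fR _ _; rewrite ?k1.
split; first exact: a0_zero_linear.
exists (landen_map_a0 m k d); split; first exact: landen_map_induces.
  exact: landen_map_a0_dominant.
exact: (reduced_algebraic_degree (@landen_map_a0_reduced m k d hd) (ratmap_eq_refl _)).
Qed.
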